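(* Let $1\le m<K$ be an integer and $\mathcal A=\{A\subset[K]:|A|=m\}$. Assume that for each $k\in[K]$ and $(i,i')\in\{(0,1),(1,0)\}$, $\int\log(f_i^k/f_{i'}^k)f_i^k\,d\mu^k>0$ and $\int[\log(f_i^k/f_{i'}^k)]^2f_i^k\,d\mu^k<\infty$. For $\alpha\in(0,1)$ let $b_\alpha=|\log\alpha|+\log[m(K-m)]$. Then the Gap rule $\{\delta_G(b_\alpha)\}$ is second-order asymptotically optimal in $\{\Delta_m^{\mathrm{kns}}(\alpha)\}$ as $\alpha\to0$, that is, for each $A\in\mathcal A$, $$\limsup_{\alpha\to0}\Bigl(\mathbb E_A[T_G(b_\alpha)]-T_A^{\min}\bigl(\Delta_m^{\mathrm{kns}}(\alpha)\bigr)\Bigr)<\infty.$$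
   Context: $K\ge2$, $[K]=\{1,\dots,K\}$. For each $k\in[K]$, $\mu^k$ is a $\sigma$-finite measure on a measurable space $\mathcal X^k$ and $f_0^k,f_1^k$ are probability densities with respect to $\mu^k$. One observes $K$ independent streams $\{\mathbf X_t^k:t\ge1\}$, each i.i.d. For $A\subset[K]$, $\mathbb P_A$ (expectation $\mathbb E_A$) is the law under which the streams are independent and stream $k$ is i.i.d. with density $f_1^k$ if $k\in A$ and $f_0^k$ if $k\notin A$. $\mathcal F_t$ is the $\sigma$-field generated by all observations from all streams up to time $t$. A sequential procedure is a pair $(T,D)$ with $T$ an $\{\mathcal F_t\}_{t\ge1}$-stopping time and $D$ an $\mathcal F_T$-measurable decision with values in $\mathcal A$; $\Delta$ is the class of all such procedures. For $\Delta'\subset\Delta$, $T_A^{\min}(\Delta')=\inf_{(T,D)\in\Delta'}\mathbb E_A[T]$. The class for a known number $m$ of signals is $\Delta_m^{\mathrm{kns}}(\alpha)=\{(T,D)\in\Delta:\max_{A\in\mathcal A}\mathbb P_A(D\ne A)\le\alpha\}$. Log-likelihood ratios: $\lambda_t^k=\sum_{s=1}^t\log\frac{f_1^k(\mathbf X_s^k)}{f_0^k(\mathbf X_s^k)}$. Let $\bar\lambda_t^{(1)}\le\cdots\le\bar\lambda_t^{(K)}$ be the order statistics of $\{\lambda_t^k:k\in[K]\}$ (no absolute values), with stream indices $\bar j_1(t),\dots,\bar j_K(t)$, so $\lambda_t^{\bar j_i(t)}=\bar\lambda_t^{(i)}$. The Gap rule $\delta_G(b)=(T_G(b),D_G(b))$,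 $b>0$, is $T_G(b)=\min\{t\ge1:\bar\lambda_t^{(K-m+1)}-\bar\lambda_t^{(K-m)}\ge b\}$, $D_G(b)=\{\bar j_{K-m+1}(t),\dots,\bar j_K(t)\}$ evaluated at $t=T_G(b)$. It is known from earlier work that $\delta_G(b_\alpha)\in\Delta_m^{\mathrm{kns}}(\alpha)$. *)

(* Defs.v *)
From HB Require Import structures.
From mathcomp Require Import all_boot all_order all_algebra finmap.
From mathcomp Require Import all_classical all_reals all_analysis.

Set Implicit Arguments.
Unset Strict Implicit.
Unset Printing Implicit Defensive.

Import Order.TTheory GRing.Theory Num.Theory numFieldNormedType.Exports.

Local Open Scope classical_set_scope.
Local Open Scope ring_scope.

Section densities.
Context {R : realType} {d : measure_display} {T : measurableType d}.

Definition is_density (mu : {measure set T -> \bar R}) (f : T -> R) : Prop :=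
  [/\ measurable_fun setT f, forall x, 0 <= f x
    & (\int[mu]_x (f x)%:E = 1)%E].

(* log (p / q) with values in [-oo, +oo]: it is +oo where q vanishes and p does
   not (since (0%:E)^-1 = +oo), and -oo where p vanishes.  In particular the
   integral of (log_ratio p q)^2 p is +oo unless p is absolutely continuous
   with respect to q; where p = 0 the integrand is 0. *)
Definition log_ratio (p q : T -> R) (x : T) : \bar R :=
  lne ((p x)%:E / (q x)%:E)%E.

End densities.

Definition mutually_independent {R : realType} {d : measure_display}
    {Omega : measurableType d} {I : choiceType} {dT : I -> measure_display}
    {T : forall i : I, measurableType (dT i)}
    (P : probability Omega R) (Y : forall i : I, Omega -> T i) : Prop :=
  forall (J : {fset I}) (B : forall i : I, set (T i)),
    (forall i, i \in J -> measurable (B i)) ->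
    P (\bigcap_(i in [set` J]) (Y i @^-1` B i)) =
      (\prod_(i <- J) P (Y i @^-1` B i))%E.

(* Least t with p t, None if there is none. *)
Definition first_time (p : pred nat) : option nat :=
  if pselect (exists t, p t) is left ex_p then Some (ex_minn ex_p) else None.

(* Random times take values in option nat, None standing for +oo. *)
Definition etime {R : realType} (t : option nat) : \bar R :=
  if t is Some n then n%:R%:E else +oo%E.

Definition time_le (s : option nat) (t : nat) : bool :=
  if s is Some n then (n <= t)%N else false.

Section sequential_testing.
Context {R : realType} {K : nat}.
Context {dO : measure_display} {Omega : measurableType dO}.
Context {dX : 'I_K -> measure_display} {X : forall k, measurableType (dX k)}.

(* f i k is the density f_i^k, with i = false for 0 and i = true for 1.
   Observations are numbered from 0: obs s k is the (s+1)-st observation of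
   stream k, so that the observations up to time t are those with s < t. *)
Implicit Types (f : bool -> forall k, X k -> R)
  (obs : nat -> forall k : 'I_K, Omega -> X k)
  (P : {set 'I_K} -> probability Omega R).

Definition streams_law (mu : forall k, {measure set (X k) -> \bar R}) f obs P
    : Prop :=
  [/\ forall s k, measurable_fun setT (obs s k),
      forall A s k (B : set (X k)), measurable B ->
        P A (obs s k @^-1` B) = (\int[mu k]_(x in B) (f (k \in A) k x)%:E)%E
    & forall A, mutually_independent (P A)
        (fun i : nat * 'I_K => obs i.1 i.2)].

Definition Ffilt obs (t : nat) : set (set Omega) :=
  <<s [set E | exists s k (B : set (X k)),
         [/\ (s < t)%N, measurable B & E = obs s k @^-1` B] ]>>.

Definition Finfty obs : set (set Omega) := <<s \bigcup_t Ffilt obs t >>.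

Definition stopping_time obs (T : Omega -> option nat) : Prop :=
  (forall w, ~~ time_le (T w) 0) /\
  forall t, (0 < t)%N -> Ffilt obs t [set w | time_le (T w) t].

Definition Fstop obs (T : Omega -> option nat) : set (set Omega) :=
  [set E | Finfty obs E /\
     forall t, (0 < t)%N -> Ffilt obs t (E `&` [set w | time_le (T w) t])].

Definition procedure : Type :=
  ((Omega -> option nat) * (Omega -> {set 'I_K}))%type.

Definition Delta obs (calA : {set {set 'I_K}}) : set procedure :=
  [set delta | [/\ stopping_time obs delta.1,
      forall w, delta.2 w \in calA
    & forall B : {set 'I_K}, Fstop obs delta.1 [set w | delta.2 w = B] ] ].

Definition signals (m : nat) : {set {set 'I_K}} := [set A : {set 'I_K} | #|A| == m].

Definition Delta_kns obs P (m : nat) (alpha : R) : set procedure :=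
  [set delta | Delta obs (signals m) delta /\
     forall A, A \in signals m ->
       (P A [set w | delta.2 w <> A] <= alpha%:E)%E].

Definition Etime P (A : {set 'I_K}) (T : Omega -> option nat) : \bar R :=
  (\int[P A]_w etime (T w))%E.

Definition Tmin P (A : {set 'I_K}) (D : set procedure) : \bar R :=
  ereal_inf [set Etime P A delta.1 | delta in D].

Definition llr f obs (t : nat) (k : 'I_K) (w : Omega) : \bar R :=
  (\sum_(s < t) log_ratio (f true k) (f false k) (obs s k w))%E.

(* The streams j_1(t), ..., j_K(t) by increasing log-likelihood ratio; ties are
   broken by stream index, as sort is stable. *)
Definition ranking f obs (t : nat) (w : Omega) : seq 'I_K :=
  sort (fun j k => llr f obs t j w <= llr f obs t k w)%E (enum 'I_K).

(* i-th smallest log-likelihood ratio at time t, for 1 <= i <= K. *)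
Definition order_stat f obs (t i : nat) (w : Omega) : \bar R :=
  nth 0%E [seq llr f obs t k w | k <- ranking f obs t w] i.-1.

Definition TG f obs (m : nat) (b : R) (w : Omega) : option nat :=
  first_time (fun t => (0 < t)%N &&
    (b%:E <= order_stat f obs t (K - m + 1) w - order_stat f obs t (K - m) w)%E).

(* When TG is infinite the decision is the ranking at time 0, a fixed set. *)
Definition DG f obs (m : nat) (b : R) (w : Omega) : {set 'I_K} :=
  [set k in drop (K - m) (ranking f obs (odflt 0%N (TG f obs m b w)) w)].

Definition gap_rule f obs (m : nat) (b : R) : procedure :=
  (TG f obs m b, DG f obs m b).

Definition second_order_optimal P (calA : {set {set 'I_K}})
    (delta : R -> procedure) (D : R -> set procedure) : Prop :=
  forall A, A \in calA ->
    (limf_esup (fun alpha : R => Etime P A (delta alpha).1 - Tmin P A (D alpha))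
       (0 : R)^'+ < +oo)%E.

End sequential_testing.

(* Main.v *)
Require Import Defs.
From HB Require Import structures.
From mathcomp Require Import all_boot all_order all_algebra finmap.
From mathcomp Require Import all_classical all_reals all_analysis.
From mathcomp Require Import measurable_realfun ring lra zify.

Import Order.TTheory GRing.Theory Num.Theory numFieldNormedType.Exports.
Local Open Scope classical_set_scope.
Local Open Scope ring_scope.

Set Implicit Arguments.
Unset Strict Implicit.
Unset Printing Implicit Defensive.

(** Fix the set [A] of signals that governs the data. Call a pair of streams
(j, i) separating when j is a signal and i is not. Under [P A] the gap of such
a pair, the log-likelihood ratio of j minus that of i, is a random walk with
positive drift and square-integrable steps, and exp (- gap) is the likelihood
ratio with respect to [P A] of the law [P (swap A (j, i))], in which j and i
exchange their roles.

At any time at which all separating gaps are at least b, the m largest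
log-likelihood ratios exceed the others by at least b, so the gap rule has
stopped ([gaps_above_TG]). It remains to show that the first such time, tau,
exceeds the stopping time T of any competitor (T, D) by an amount whose
[P A]-expectation is bounded uniformly in alpha and in the competitor.

The excess of tau over T is controlled by the Lyapunov function V(t), the sum
over the separating pairs of the squared positive parts of b + M - gap(t). A
deficit d moves to at most |d - x| after a step x of its gap, and the mean of
(d - x)^2 is d^2 - 2 d E[x] + E[x^2]. Before tau some deficit is at least M, so
for M large the mean of V drops by at least 1 at each step
([lyapunov_drift]). Started at time T, this bounds the expected excess by
the mean of V(T) ([lyapunov_sum]). That mean is bounded as follows
([excess_bound]).
- Where D = A, V(T) is at most 4 exp (b + M) times the sum of the likelihood
  ratios exp (- gap(T)). Changing the law, the mean of each of them over D = A
  is the probability of D = A under a wrong hypothesis, hence at most alpha,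
  while exp b = m (K - m) / alpha.
- Where D <> A, an event of probability at most alpha, V(T) is at most the sum
  of 2 (b + M)^2 + 8 exp (- gap(T)). Since b grows only like the logarithm of
  1 / alpha, alpha b^2 is bounded, and each likelihood ratio has mean at most 1.
Both bounds together are [threshold_bound].

The independence of the next observations from the past and the change of law
come from the monotone class theorem on finite cylinders
([cylinder_independent], [change_of_law]). Finiteness of the second moments
of the log-ratios forces the two densities of a stream to have almost
everywhere the same support ([ae_pos_density]), so almost surely all
log-likelihood ratios are finite and one can work with real-valued walks. *)

(** * Integrals of real random variables *)

Section real_integrals.
Context {R : realType} {d : measure_display} {T : measurableType d}.
Variable mu : {measure set T -> \bar R}.
Implicit Types f g : T -> R.

Lemma integrable_dominated f g : measurable_fun setT f ->
  mu.-integrable setT (EFin \o g) -> (forall x, `|f x| <= g x) ->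
  mu.-integrable setT (EFin \o f).
Proof.
move=> mf ig fg; apply: (le_integrable measurableT _ _ ig).
  exact/measurable_EFinP.
move=> x _ /=; rewrite lee_fin.
by rewrite (ger0_norm (le_trans (normr_ge0 _) (fg x))).
Qed.

Definition sq_integrable f :=
  measurable_fun setT f /\ mu.-integrable setT (fun x => (f x ^+ 2)%:E).

Lemma sq_integrableM f g : sq_integrable f -> sq_integrable g ->
  mu.-integrable setT (fun x => (f x * g x)%:E).
Proof.
move=> [mf If] [mg Ig].
apply: (@integrable_dominated _ (fun x => f x ^+ 2 + g x ^+ 2)).
- exact: measurable_funM.
- exact: (integrableD _ If Ig).
- move=> x; rewrite ler_norml; apply/andP; split; nra.
Qed.

End real_integrals.

Section independent_product.
Context {R : realType} {d : measure_display} {T : measurableType d}.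
Variable P : probability T R.

(** The joint law of [f] and [g] is the product of their laws, so the mean of
the product is a double integral that factors by Fubini's theorem. *)
Lemma integral_independentM (f g : T -> R) :
  P.-integrable setT (EFin \o f) -> P.-integrable setT (EFin \o g) ->
  (forall A B : set R, measurable A -> measurable B ->
    P (f @^-1` A `&` g @^-1` B) = (P (f @^-1` A) * P (g @^-1` B))%E) ->
  P.-integrable setT (fun x => (f x * g x)%:E) /\
  (\int[P]_x (f x * g x)%:E = \int[P]_x (f x)%:E * \int[P]_x (g x)%:E)%E.
Proof.
move=> If Ig indep.
have mf : measurable_fun setT f by exact/measurable_EFinP/(measurable_int _ If).
have mg : measurable_fun setT g by exact/measurable_EFinP/(measurable_int _ Ig).
pose F : {RV P >-> R} := HB.pack f (isMeasurableFun.Build _ _ _ _ _ mf).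
pose G : {RV P >-> R} := HB.pack g (isMeasurableFun.Build _ _ _ _ _ mg).
have mH : measurable_fun setT (fun x => (f x, g x)).
  by apply: measurable_fun_pair.
pose H : {RV P >-> _} := HB.pack (fun x => (f x, g x))
  (isMeasurableFun.Build _ _ _ _ _ mH).
pose m : {measure set (R * R) -> \bar R} := distribution P H.
have mE A : measurable A -> (distribution P F \x distribution P G)%E A = m A.
  apply: product_measure_unique => {A}A B mA mB; rewrite -indep//.
have mmul : measurable_fun setT (fun z : R * R => (z.1 * z.2)%:E).
  by apply/measurable_EFinP; apply: measurable_funM.
have fin (X : {RV P >-> R}) : P.-integrable setT (EFin \o X) ->
    (distribution P X).-integrable setT EFin.
  move=> IX; apply/integrableP; split; first exact/measurable_EFinP.
  rewrite ge0_integral_distribution//; last exact: measurableT_comp.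
  by case/integrableP: IX.
have fF := fin F If; have fG := fin G Ig.
have expE (X : {RV P >-> R}) : P.-integrable setT (EFin \o X) ->
    (\int[distribution P X]_x x%:E = \int[P]_x (X x)%:E)%E.
  by move=> IX; rewrite integral_distribution.
have Iprod : (distribution P F \x distribution P G)%E.-integrable setT
    (fun z : R * R => (z.1 * z.2)%:E).
  apply/integrable12ltyP => //=.
  under eq_integral => x _.
    under eq_integral => y _ do rewrite normrM EFinM.
    rewrite ge0_integralZl//; last exact/measurable_EFinP.
    over.
  rewrite ge0_integralZr//.
  - case/integrableP: fF => _ /= fF; case/integrableP: fG => _ /= fG.
    apply: lte_mul_pinfty => //; first exact: integral_ge0.
    by rewrite ge0_fin_numE//; exact: integral_ge0.
  - exact/measurable_EFinP.
  - exact: integral_ge0.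
have Im : m.-integrable setT (fun z : R * R => (z.1 * z.2)%:E).
  case/integrableP: Iprod => ? h; apply/integrableP; split => //.
  rewrite (eq_measure_integral (distribution P F \x distribution P G)%E) // => B mB _.
  by rewrite -mE.
have Ifg : P.-integrable setT (fun x => (f x * g x)%:E).
  apply/integrableP; split.
    by apply/measurable_EFinP; apply: measurable_funM.
  case/integrableP: Im => _; rewrite ge0_integral_distribution//.
  exact: measurableT_comp.
split => //.
transitivity (\int[m]_z (z.1 * z.2)%:E)%E.
  by rewrite integral_distribution.
rewrite (eq_measure_integral (distribution P F \x distribution P G)%E); last first.
  by move=> B mB _; rewrite -mE.
rewrite -integral12_prod_meas1//.
rewrite /fubini_F/=.
under eq_integral => x _.
  under eq_integral => y _ do rewrite EFinM.
  rewrite integralZl// expE//.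
  over.
rewrite /= -(expE F If) .
have : (\int[P]_x (g x)%:E)%E \is a fin_num by apply: integrable_fin_num.
move=> /fineK <-.
by rewrite integralZr.
Qed.
End independent_product.

(** * Measures with a density *)

Section density_measure.
Import HBNNSimple.
Local Open Scope ereal_scope.
Context {R : realType} {d : measure_display} {T : measurableType d}.
Variables (mu : {measure set T -> \bar R}) (g : T -> R).
Hypotheses (mg : measurable_fun setT g) (g0 : forall x, (0 <= g x)%R).

(** The two proofs are arguments because the measure structure on this set
function can be attached only to a term that carries them. *)
Definition density_measure (_ : measurable_fun setT g)
  (_ : forall x, (0 <= g x)%R) (A : set T) : \bar R :=
  \int[mu]_(x in A) (g x)%:E.

Let nu := density_measure mg g0.

Let nu0 : nu set0 = 0.
Proof. by rewrite /nu /density_measure integral_set0. Qed.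

Let nu_ge0 A : 0 <= nu A.
Proof. by apply: integral_ge0 => x _; rewrite lee_fin. Qed.

Let nu_sigma_additive : semi_sigma_additive nu.
Proof.
move=> F mF tF mUF; rewrite /nu /density_measure ge0_integral_bigcup//.
- by apply: is_cvg_ereal_nneg_natsum_cond => n _ _; exact: nu_ge0.
- exact/measurable_EFinP/measurable_funTS.
- by move=> x _; rewrite lee_fin.
Qed.

HB.instance Definition _ := isMeasure.Build _ _ _ (density_measure mg g0)
  nu0 nu_ge0 nu_sigma_additive.

(** Both sides agree on simple functions, and monotone convergence does the
rest. *)
Lemma integral_density_measure (h : T -> \bar R) :
  measurable_fun setT h -> (forall x, 0 <= h x) ->
  \int[density_measure mg g0]_x h x = \int[mu]_x (h x * (g x)%:E).
Proof.
move=> mh h0; pose a := nnsfun_approx measurableT mh.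
have ha x : h x = limn (fun n => (a n x)%:E).
  by apply/esym/cvg_lim => //; apply: cvg_nnsfun_approx.
transitivity (limn (fun n => \int[nu]_x (a n x)%:E)).
  rewrite (eq_integral (fun x => limn (fun n => (a n x)%:E))) => [|x _]; last exact: ha.
  apply: monotone_convergence => //.
  - by move=> n; exact/measurable_EFinP/measurable_funP.
  - by move=> n x _; rewrite lee_fin.
  - by move=> x _ m n mn; rewrite lee_fin; exact/lefP/nd_nnsfun_approx.
transitivity (limn (fun n => \int[mu]_x ((a n x)%:E * (g x)%:E))); last first.
  have hg x : h x * (g x)%:E = limn (fun n => (a n x)%:E * (g x)%:E).
    by apply/esym/cvg_lim => //; apply: cvgeZr => //; exact: cvg_nnsfun_approx.
  rewrite [RHS](eq_integral
    (fun x => limn (fun n => (a n x)%:E * (g x)%:E))); last first.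
    by move=> x _; exact: hg.
  apply/esym/monotone_convergence => //.
  - by move=> n; apply: emeasurable_funM; exact/measurable_EFinP.
  - by move=> n x _; rewrite mule_ge0 ?lee_fin.
  - by move=> x _ m n mn; rewrite lee_wpmul2r ?lee_fin//; exact/lefP/nd_nnsfun_approx.
congr (limn _); apply/funext => n.
under [LHS]eq_integral do rewrite fimfunE -fsumEFin//.
rewrite ge0_integral_fsum//; last 2 first.
- by move=> y; exact/measurable_EFinP/measurable_funM.
- by move=> y x _; rewrite nnfun_muleindic_ge0.
transitivity (\int[mu]_x (\sum_(y \in range (a n))
    (y * \1_(a n @^-1` [set y]) x)%:E * (g x)%:E)); last first.
  apply: eq_integral => x _.
  rewrite -ge0_mule_fsuml => [|y]; last exact: nnfun_muleindic_ge0.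
  by rewrite fsumEFin // -(fimfunE _ x).
rewrite ge0_integral_fsum//; last 2 first.
  - move=> y; apply: emeasurable_funM; last exact/measurable_EFinP.
    exact/measurable_EFinP/measurable_funM.
  - by move=> y x _; rewrite mule_ge0 ?lee_fin// -lee_fin nnfun_muleindic_ge0.
apply: eq_fsbigr => r _.
rewrite integralZl_indic_nnsfun// integral_indic// setIT.
under [RHS]eq_integral do rewrite EFinM -muleA.
have [r0|r0] := leP 0%R r.
  rewrite ge0_integralZl//.
  - under [in RHS]eq_integral do rewrite muleC.
    rewrite [in RHS](eq_integral ((EFin \o g) \_ (a n @^-1` [set r]))); last first.
      by move=> x xE; rewrite epatch_indic.
    by rewrite -integral_mkcond.
  - by apply: emeasurable_funM; exact/measurable_EFinP.
  - by move=> x _; rewrite mule_ge0 ?lee_fin.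
rewrite preimage_nnfun0// measure0 mule0 integral0_eq// => x _.
by rewrite indic0 mul0e mule0.
Qed.

End density_measure.

(** Change of variables: the law of [Y] is the measure with density [p]. *)
Lemma integral_law {R : realType} {d d' : measure_display}
    {Omega : measurableType d} {T : measurableType d'}
    (P : {measure set Omega -> \bar R}) (mu : {measure set T -> \bar R})
    (Y : Omega -> T) (p : T -> R) (h : T -> \bar R) :
  measurable_fun setT Y -> measurable_fun setT p -> (forall x, 0 <= p x) ->
  (forall B, measurable B -> P (Y @^-1` B) = \int[mu]_(x in B) (p x)%:E)%E ->
  measurable_fun setT h -> (forall x, 0 <= h x)%E ->
  (\int[P]_w h (Y w) = \int[mu]_x (h x * (p x)%:E))%E.
Proof.
move=> mY mp p0 PY mh h0.
rewrite -(integral_density_measure mu mp p0)//.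
pose X : {mfun Omega >-> T} := HB.pack Y (isMeasurableFun.Build _ _ _ _ _ mY).
transitivity (\int[pushforward P X]_x h x)%E.
  by rewrite ge0_integral_pushforward.
by apply: eq_measure_integral => B mB _; exact: (PY B mB).
Qed.

(** * Independent coordinates *)

Section coordinates.
Context {d : measure_display} {Omega : measurableType d} {I : choiceType}
  {dT : I -> measure_display} {T : forall i, measurableType (dT i)}.
Variable Y : forall i, Omega -> T i.
Hypothesis mY : forall i, measurable_fun setT (Y i).

Definition coord_event (i : I) : set (set Omega) :=
  [set E | exists2 B : set (T i), measurable B & E = Y i @^-1` B].

(** The events [D i] range over all indices, so that intersecting two cylinders
is an intersection index by index. The cylinders over [J] are a pi-system that
generates the sigma-algebra of the coordinates in [J], as needed to compare
measures on it. *)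
Definition cylinder (J : {fset I}) : set (set Omega) :=
  [set E | exists2 D : I -> set Omega,
    forall i, coord_event i (D i) & E = \bigcap_(i in [set` J]) D i].

Lemma coord_eventT i : coord_event i setT.
Proof. by exists setT. Qed.

Lemma coord_eventI i E F :
  coord_event i E -> coord_event i F -> coord_event i (E `&` F).
Proof.
move=> [A mA ->] [B mB ->]; exists (A `&` B); first exact: measurableI.
by rewrite preimage_setI.
Qed.

Lemma measurable_coord_event i E : coord_event i E -> measurable E.
Proof. by move=> [B mB ->]; rewrite -[_ @^-1` _]setTI; exact: mY. Qed.

Lemma coord_event_cylinder (J : {fset I}) i E :
  i \in J -> coord_event i E -> cylinder J E.
Proof.
move=> iJ iE; exists (fun j => if j == i then E else setT).
  by move=> j; case: eqVneq => [->//|_]; exact: coord_eventT.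
apply/seteqP; split=> [w Ew j _ /=|w /(_ i iJ)/=]; last by rewrite eqxx.
by case: ifP.
Qed.

Lemma cylinder_setI_closed J : setI_closed (cylinder J).
Proof.
move=> _ _ [D hD ->] [D' hD' ->]; exists (fun i => D i `&` D' i).
  by move=> i; exact: coord_eventI.
by rewrite bigcapI.
Qed.

Lemma cylinderT J : cylinder J setT.
Proof.
exists (fun=> setT); first by move=> i; exact: coord_eventT.
by apply/seteqP; split.
Qed.

Lemma cylinder_measurable J : cylinder J `<=` measurable.
Proof.
move=> _ [D hD ->]; apply: fin_bigcap_measurable => [|i _].
  exact: finite_fset.
exact: measurable_coord_event (hD i).
Qed.

Lemma sigma_cylinder_measurable J : <<s cylinder J >> `<=` measurable.
Proof.
apply: smallest_sub; last exact: cylinder_measurable.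
exact: sigma_algebra_measurable.
Qed.

Lemma measurable_coord_cylinder J i : i \in J ->
  measurable_fun (setT : set (g_sigma_algebraType (cylinder J))) (Y i).
Proof.
move=> iJ _ B mB; rewrite setTI; apply: sub_gen_smallest.
by apply: (coord_event_cylinder iJ); exists B.
Qed.

Section law.
Context {R : realType} (P : probability Omega R).
Hypothesis indepY : mutually_independent P Y.

Lemma coord_event_bigcap (J : {fset I}) (D : I -> set Omega) :
  (forall i, coord_event i (D i)) ->
  P (\bigcap_(i in [set` J]) D i) = (\prod_(i <- J) P (D i))%E.
Proof.
move=> hD; pose B i := s2val (cid2 (hD i)).
have mB i : measurable (B i) by rewrite /B; case: cid2.
have DB i : D i = Y i @^-1` B i by rewrite /B; case: cid2.
rewrite (funext DB : D = _); exact: indepY.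
Qed.

(** As functions of [E], both sides are finite measures. On cylinders they agree
by mutual independence over the index set enlarged by [k], hence they agree on
the generated sigma-algebra. *)
Lemma cylinder_independent (J : {fset I}) k E D :
  k \notin J -> <<s cylinder J >> E -> coord_event k D ->
  P (E `&` D) = (P E * P D)%E.
Proof.
move=> kJ sE kD.
have mD := measurable_coord_event kD.
have p0 : 0 <= fine (P D) by exact: fine_ge0.
have pE : (fine (P D))%:E = P D by apply: fineK; exact: fin_num_measure.
have rE A : mscale (NngNum p0) P A = (P D * P A)%E by rewrite -[in RHS]pE.
suff: mrestr P mD E = mscale (NngNum p0) P E.
  by rewrite rE muleC.
move: sE.
apply: (g_sigma_algebra_measure_unique _ _ (fun=> setT)).
- exact: cylinder_measurable.
- by move=> _; exact: cylinderT.
- by rewrite bigcup_const.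
- exact: cylinder_setI_closed.
- move=> _ [G hG ->]; rewrite [RHS]rE; change (P (\bigcap_(i in [set` J]) G i `&` D) =
    (P D * P (\bigcap_(i in [set` J]) G i))%E).
  pose G' i := if i == k then D else G i.
  have hG' i : coord_event i (G' i) by rewrite /G'; case: eqVneq => [->|_].
  have G'E i : i \in J -> G' i = G i.
    by rewrite /G'; case: eqVneq => // ->; rewrite (negbTE kJ).
  rewrite coord_event_bigcap//.
  have -> : \bigcap_(i in [set` J]) G i `&` D =
      \bigcap_(i in [set` (k |` J)%fset]) G' i.
    rewrite bigcap_fsetU1 {1}/G' eqxx setIC; congr (_ `&` _).
    by apply: eq_bigcapr => i /= iJ; rewrite G'E.
  rewrite coord_event_bigcap// big_fsetU1//= {1}/G' eqxx; congr (_ * _)%E.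
  by rewrite big_seq [RHS]big_seq; apply: eq_bigr => i iJ; rewrite G'E.
- move=> _; change (P (setT `&` D) < +oo)%E; rewrite setTI.
  exact: le_lt_trans (probability_le1 _ mD) (ltry _).
Qed.

(** Induction on the index set: the partial product is a function of the
coordinates already treated, hence independent of the next one. *)
Lemma integral_prod_independent (J : {fset I}) (h : forall i, T i -> R) :
  (forall i, measurable_fun setT (h i)) ->
  (forall i, P.-integrable setT (fun w => (h i (Y i w))%:E)) ->
  P.-integrable setT (fun w => (\prod_(i <- J) h i (Y i w))%:E) /\
  (\int[P]_w (\prod_(i <- J) h i (Y i w))%:E =
   \prod_(i <- J) \int[P]_w (h i (Y i w))%:E)%E.
Proof.
move=> mh Ih; elim/fset1U_rect: J => [|k J kJ [IJ EJ]].
  under [X in _.-integrable _ X]eq_fun do rewrite big_seq_fset0.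
  rewrite big_seq_fset0; under eq_integral do rewrite big_seq_fset0.
  split; first exact: finite_measure_integrable_cst.
  by rewrite integral_cst// mul1e; exact: probability_setT.
under [X in _.-integrable _ X]eq_fun do rewrite big_fsetU1//= mulrC.
rewrite big_fsetU1//=; under eq_integral do rewrite big_fsetU1//= mulrC.
rewrite -EJ muleC; apply: (integral_independentM IJ (Ih k)) => A B mA mB.
apply: cylinder_independent kJ _ _.
  have /(_ measurableT A mA) : measurable_fun
      (setT : set (g_sigma_algebraType (cylinder J)))
      (fun w => \prod_(i <- J) h i (Y i w)).
    apply: measurable_prod => i iJ.
    by apply: measurableT_comp => //; exact: measurable_coord_cylinder.
  by rewrite setTI.
exists (h k @^-1` B) => //.
by rewrite -[_ @^-1` _]setTI; exact: mh.
Qed.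

End law.

Section change_of_law.
Context {R : realType} (P Q : probability Omega R).
Hypotheses (indepP : mutually_independent P Y)
  (indepQ : mutually_independent Q Y).
Variable r : forall i, T i -> R.
Arguments r : clear implicits.
Hypotheses (mr : forall i, measurable_fun setT (r i))
  (r0 : forall i x, 0 <= r i x)
  (PQ : forall i B, measurable B ->
    (\int[P]_(w in Y i @^-1` B) (r i (Y i w))%:E = Q (Y i @^-1` B))%E).

(** The likelihood ratio of finitely many independent coordinates is the product
of the individual ones. Both sides are finite measures in [E]; on a cylinder
the identity reduces to one factor per coordinate because means of independent
factors multiply. *)
Lemma change_of_law (J : {fset I}) E : <<s cylinder J >> E ->
  (\int[P]_(w in E) (\prod_(i <- J) r i (Y i w))%:E = Q E)%E.
Proof.
have mM : measurable_fun setT (fun w => \prod_(i <- J) r i (Y i w)).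
  by apply: measurable_prod => i _; exact: measurableT_comp.
have M0 w : 0 <= \prod_(i <- J) r i (Y i w).
  by apply: prodr_ge0 => i _.
rewrite -[LHS]/(density_measure P mM M0 E).
have Ir i : P.-integrable setT (fun w => (r i (Y i w))%:E).
  apply/integrableP; split; first by apply/measurable_EFinP; exact: measurableT_comp.
  under eq_integral do rewrite gee0_abs ?lee_fin//.
  have := @PQ i setT measurableT; rewrite preimage_setT => ->.
  exact: le_lt_trans (probability_le1 _ measurableT) (ltry _).
apply: (g_sigma_algebra_measure_unique _ _ (fun=> setT)).
- exact: cylinder_measurable.
- by move=> _; exact: cylinderT.
- by rewrite bigcup_const.
- exact: cylinder_setI_closed.
- move=> _ [D hD ->]; transitivity (\prod_(i <- J) Q (D i))%E; last first.
    by apply/esym; exact: (coord_event_bigcap indepQ).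
  change (\int[P]_(w in \bigcap_(i in [set` J]) D i)
    (\prod_(i <- J) r i (Y i w))%:E = \prod_(i <- J) Q (D i))%E.
  pose B i := s2val (cid2 (hD i)).
  have mB i : measurable (B i) by rewrite /B; case: cid2.
  have DB i : D i = Y i @^-1` B i by rewrite /B; case: cid2.
  rewrite integral_mkcond.
  pose h i x : R := r i x * \1_(B i) x.
  have mh i : measurable_fun setT (h i) by apply: measurable_funM.
  rewrite (eq_integral (fun w => (\prod_(i <- J) h i (Y i w))%:E)); last first.
    move=> w _; rewrite epatch_indic /= -EFinM; congr EFin.
    rewrite big_split /=; congr (_ * _).
    rewrite bigcap_fset.
    rewrite (big_morph (fun A => \1_A w : R) (op1 := *%R) (id1 := 1)).
    + by apply: eq_bigr => i _; rewrite DB.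
    + by move=> A A'; rewrite indicI.
    + by rewrite indicT.
  have Ih i : P.-integrable setT (fun w => (h i (Y i w))%:E).
    apply: (integrable_dominated (g := fun w => r i (Y i w)) _ (Ir i)) => [|w].
      by apply: measurableT_comp.
    rewrite /h normrM (ger0_norm (@r0 _ _)) ler_piMr// indicE.
    by case: (_ \in _); rewrite ?normr1 ?normr0.
  have [_ ->] := integral_prod_independent indepP J mh Ih.
  apply: eq_bigr => i _; rewrite DB -PQ// [RHS]integral_mkcond.
  by apply: eq_integral => w _; rewrite epatch_indic /= -EFinM.
- move=> _; change (\int[P]_w (\prod_(i <- J) r i (Y i w))%:E < +oo)%E.
  have [/integrableP[_]] := integral_prod_independent indepP J mr Ir.
  by under eq_integral do rewrite gee0_abs ?lee_fin//.
Qed.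

End change_of_law.
End coordinates.

(** * Log-likelihood ratio of two densities *)

Section score.
Context {R : realType} {d : measure_display} {T : measurableType d}.
Variables (mu : {measure set T -> \bar R}) (p q : T -> R).
Hypotheses (mp : measurable_fun setT p) (mq : measurable_fun setT q).
Hypotheses (p0 : forall x, 0 <= p x) (q0 : forall x, 0 <= q x).

(** A real-valued version of the log-ratio. As [ln 0 = 0], it is antisymmetric
in the two densities without exception, which makes the two directions of
comparison symmetric. *)
Definition score (u v : T -> R) (x : T) : R := ln (u x) - ln (v x).

Lemma measurable_score (u v : T -> R) : measurable_fun setT u ->
  measurable_fun setT v -> measurable_fun setT (score u v).
Proof. by move=> mu' mv; apply: measurable_funB; exact: measurableT_comp. Qed.

Lemma log_ratioE (u v : T -> R) x : 0 <= u x -> 0 <= v x ->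
  log_ratio u v x = if 0 < u x then
    if 0 < v x then (score u v x)%:E else +oo%E else -oo%E.
Proof.
move=> u0 v0; rewrite /log_ratio inver.
have [up|un] := ltP 0 (u x); last first.
  have -> : u x = 0 by apply/eqP; rewrite eq_le un u0.
  by rewrite mul0e le0_lneNy.
have [vp|vn] := ltP 0 (v x); last first.
  have -> : v x = 0 by apply/eqP; rewrite eq_le vn v0.
  by rewrite eqxx gt0_muley// lte_fin.
rewrite gt_eqF// -EFinM lne_EFin ?divr_gt0//.
by rewrite lnM ?posrE ?invr_gt0// lnV ?posrE.
Qed.

Lemma measurable_log_ratio (u v : T -> R) :
  measurable_fun setT u -> measurable_fun setT v ->
  (forall x, 0 <= u x) -> (forall x, 0 <= v x) ->
  measurable_fun setT (log_ratio u v).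
Proof.
move=> mu' mv u0 v0.
rewrite (_ : log_ratio u v = fun x => if 0 < u x then
    if 0 < v x then (score u v x)%:E else +oo%E else -oo%E); last first.
  by apply/funext => x; exact: log_ratioE.
apply: measurable_fun_ifT => //; first exact: measurable_fun_ltr.
apply: measurable_fun_ifT => //; first exact: measurable_fun_ltr.
by apply/measurable_EFinP; exact: measurable_score.
Qed.

(** Where [p] is positive and [q] vanishes the log-ratio is infinite, so this
set is null as soon as the second moment is finite. Applied in both directions
it shows that the two densities have the same support. *)
Lemma ae_pos_density :
  (\int[mu]_x ((log_ratio p q x) ^+ 2 * (p x)%:E) < +oo)%E ->
  {ae mu, forall x, 0 < p x -> 0 < q x}.
Proof.
move=> fin2.
have mg : measurable_fun setT (fun x => (log_ratio p q x) ^+ 2 * (p x)%:E)%E.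
  apply: emeasurable_funM; last exact/measurable_EFinP.
  have ml := measurable_log_ratio mp mq p0 q0.
  exact: (emeasurable_funM ml ml).
have Ig : mu.-integrable setT
    (fun x => (log_ratio p q x) ^+ 2 * (p x)%:E)%E.
  apply/integrableP; split => //.
  rewrite (eq_integral (fun x => (log_ratio p q x) ^+ 2 * (p x)%:E)%E)//.
  by move=> x _; rewrite gee0_abs// mule_ge0 ?lee_fin// sqre_ge0.
have := integrable_ae measurableT Ig.
apply: filterS => x /(_ I) gfin px; rewrite ltNge; apply/negP => qx.
have lr : log_ratio p q x = +oo%E by rewrite log_ratioE// px ltNge qx.
by move: gfin; rewrite lr expe2 mulyy gt0_mulye.
Qed.

End score.

Section score_law.
Context {R : realType} {d d' : measure_display} {Omega : measurableType d}
  {T : measurableType d'}.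
Variables (mu : {measure set T -> \bar R}) (p q : T -> R).
Hypotheses (mp : measurable_fun setT p) (mq : measurable_fun setT q).
Hypotheses (p0 : forall x, 0 <= p x) (q0 : forall x, 0 <= q x).
Hypothesis supp_pq : {ae mu, forall x, (0 < p x) = (0 < q x)}.
Variables (P Q : probability Omega R) (Y : Omega -> T).
Hypotheses (mY : measurable_fun setT Y)
  (PY : forall B, measurable B ->
    (P (Y @^-1` B) = \int[mu]_(x in B) (p x)%:E)%E)
  (QY : forall B, measurable B ->
    (Q (Y @^-1` B) = \int[mu]_(x in B) (q x)%:E)%E).

Let mscore : measurable_fun setT (score p q) := measurable_score mp mq.

Let le0_eq0 (u : T -> R) x : 0 <= u x -> (0 < u x) = false -> u x = 0.
Proof. by move=> u0 /negbT; rewrite -leNgt => un; apply/eqP; rewrite eq_le un. Qed.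

(** The signed case, from the positive and the negative part of [h]. *)
Lemma integral_law_real (h : T -> R) : measurable_fun setT h ->
  (\int[P]_w (h (Y w))%:E = \int[mu]_x ((h x)%:E * (p x)%:E))%E.
Proof.
move=> mh; rewrite [LHS]integralE [RHS]integralE; congr (_ - _)%E.
- rewrite (eq_integral (fun w => (EFin \o h)^\+%E (Y w))); last first.
    by move=> w _; rewrite !funeposE.
  rewrite (integral_law mY mp p0 PY)//.
  + apply: eq_integral => x _; rewrite !funeposE /=.
    by rewrite maxe_pMl ?lee_fin// mul0e.
  + exact/measurable_funepos/measurable_EFinP.
- rewrite (eq_integral (fun w => (EFin \o h)^\-%E (Y w))); last first.
    by move=> w _; rewrite !funenegE.
  rewrite (integral_law mY mp p0 PY)//.
  + apply: eq_integral => x _; rewrite !funenegE /=.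
    by rewrite maxe_pMl ?lee_fin// mul0e -EFinM mulNr.
  + exact/measurable_funeneg/measurable_EFinP.
Qed.

Lemma sq_integrable_score :
  (\int[mu]_x ((log_ratio p q x) ^+ 2 * (p x)%:E) < +oo)%E ->
  sq_integrable P (score p q \o Y).
Proof.
move=> fin2; split; first exact: measurableT_comp.
have mh : measurable_fun setT (fun x => (score p q x ^+ 2)%:E).
  by apply/measurable_EFinP; exact: measurable_funX.
apply/integrableP; split; first exact: (measurableT_comp mh).
under eq_integral do rewrite gee0_abs ?lee_fin ?sqr_ge0//.
rewrite (integral_law mY mp p0 PY mh); last by move=> x; rewrite lee_fin sqr_ge0.
apply: le_lt_trans fin2.
rewrite le_eqVlt; apply/orP; left; apply/eqP/ae_eq_integral => //.
- by apply: emeasurable_funM => //; exact/measurable_EFinP.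
- apply: emeasurable_funM; last exact/measurable_EFinP.
  have ml := measurable_log_ratio mp mq p0 q0.
  exact: (emeasurable_funM ml ml).
apply: filterS supp_pq => x + _; rewrite log_ratioE//.
case: (ltP 0 (p x)) => [_ <-|pn _]; first by rewrite -EFin_expe.
by rewrite (le0_eq0 (p0 x)) ?mule0// ltNge pn.
Qed.

Lemma integral_score_gt0 :
  (0 < \int[mu]_x (log_ratio p q x * (p x)%:E))%E ->
  (0 < \int[P]_w (score p q (Y w))%:E)%E.
Proof.
suff -> : (\int[P]_w (score p q (Y w))%:E =
    \int[mu]_x (log_ratio p q x * (p x)%:E))%E by [].
rewrite integral_law_real//; apply: ae_eq_integral => //.
- by apply: emeasurable_funM => //; exact/measurable_EFinP.
- by apply: emeasurable_funM; [exact: measurable_log_ratio|exact/measurable_EFinP].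
apply: filterS supp_pq => x + _; rewrite log_ratioE//.
case: (ltP 0 (p x)) => [_ <-//|pn _].
by rewrite (le0_eq0 (p0 x)) ?mule0// ltNge pn.
Qed.

(** Almost everywhere [p] and [q] are both positive, and then
[expR (- score p q) * p = q], or both zero, and then both sides vanish. *)
Lemma change_law_score B : measurable B ->
  (\int[P]_(w in Y @^-1` B) (expR (- score p q (Y w)))%:E = Q (Y @^-1` B))%E.
Proof.
move=> mB; rewrite QY// [LHS]integral_mkcond [RHS]integral_mkcond.
pose h x : R := expR (- score p q x) * \1_B x.
have mh : measurable_fun setT h.
  apply: measurable_funM => //; apply: measurableT_comp => //.
  exact: measurableT_comp.
transitivity (\int[P]_w (h (Y w))%:E)%E.
  by apply: eq_integral => w _; rewrite epatch_indic.
rewrite integral_law_real//; apply: ae_eq_integral => //.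
- by apply: emeasurable_funM => //; exact/measurable_EFinP.
- by apply/(measurable_restrictT _ _).1 => //; apply/measurable_funTS/measurable_EFinP.
apply: filterS supp_pq => x pq _; rewrite epatch_indic /= -!EFinM; congr EFin.
rewrite /h mulrAC; congr (_ * _).
move: pq; case: (ltP 0 (p x)) => [px /esym qx|pn].
  by rewrite /score opprB expRD expRN !lnK ?posrE// divfK// gt_eqF.
have px : p x = 0 by apply: le0_eq0 => //; rewrite ltNge pn.
by rewrite px mulr0 => /esym /(le0_eq0 (q0 x)) ->.
Qed.

Lemma prob_pos_densities :
  P [set w | ~ (0 < p (Y w) /\ 0 < q (Y w))] = 0%E.
Proof.
pose N := [set x | ~ (0 < p x /\ 0 < q x)].
have mN : measurable N.
  rewrite (_ : N = ~` ([set x | 0 < p x] `&` [set x | 0 < q x])) //.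
  apply: measurableC; apply: measurableI; rewrite -[X in measurable X]setTI.
    by apply: measurable_fun_ltr.
  by apply: measurable_fun_ltr.
rewrite -[X in P X]/(Y @^-1` N) PY//.
rewrite (ae_eq_integral (cst 0%E))//; first by rewrite integral0.
- by apply/measurable_funTS/measurable_EFinP.
apply: filterS supp_pq => x pq Nx; congr EFin; apply: le0_eq0 => //.
by apply/negP => px; apply: Nx; split => //; rewrite -pq.
Qed.

End score_law.

(** * Mean of a square after a random step *)

Section drift_step.
Context {R : realType} {d : measure_display} {Omega : measurableType d}.
Variable P : probability Omega R.

Lemma integrable_addR (f g : Omega -> R) : P.-integrable setT (EFin \o f) ->
  P.-integrable setT (EFin \o g) ->
  P.-integrable setT (EFin \o (fun w => f w + g w)).
Proof. exact: integrableD. Qed.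

Lemma integrable_scaleR k (f : Omega -> R) : P.-integrable setT (EFin \o f) ->
  P.-integrable setT (EFin \o (fun w => k * f w)).
Proof. exact: integrableZl. Qed.

Lemma sq_integrable_integrable (f : Omega -> R) : sq_integrable P f ->
  P.-integrable setT (EFin \o f).
Proof.
move=> [mf If].
have I1 : P.-integrable setT (EFin \o (fun w => 1 + f w ^+ 2)).
  exact: (integrableD measurableT (finite_measure_integrable_cst P 1 measurableT) If).
apply: (integrable_dominated _ I1) => // w.
by rewrite ler_norml; apply/andP; split; nra.
Qed.

Lemma sq_integrableD (f g : Omega -> R) : sq_integrable P f ->
  sq_integrable P g -> sq_integrable P (fun w => f w + g w).
Proof.
move=> [mf If] [mg Ig]; split; first exact: measurable_funD.
have I1 : P.-integrable setT (EFin \o (fun w => 2 * f w ^+ 2 + 2 * g w ^+ 2)).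
  by apply: integrable_addR => //; exact: integrable_scaleR.
apply: (integrable_dominated _ I1) => [|w].
  by apply: measurable_funX; exact: measurable_funD.
have h1 := sqr_ge0 (f w - g w); have h2 := sqr_ge0 (f w + g w).
have h3 := sqr_ge0 (f w); have h4 := sqr_ge0 (g w).
by rewrite ler_norml; apply/andP; split; nra.
Qed.

Lemma sq_integrable_le (f g : Omega -> R) : measurable_fun setT f ->
  sq_integrable P g -> (forall w, `|f w| <= `|g w|) -> sq_integrable P f.
Proof.
move=> mf [mg Ig] fg; split => //.
apply: (integrable_dominated _ Ig) => [|w]; first exact: measurable_funX.
by rewrite normrX -[leRHS]real_normK ?num_real// lerXn2r ?nnegrE.
Qed.

Lemma sq_integrable_cst (c : R) : sq_integrable P (fun=> c).
Proof. by split => //; exact: finite_measure_integrable_cst. Qed.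

Lemma sq_integrable_indic (f : Omega -> R) (E : set Omega) : measurable E ->
  sq_integrable P f -> sq_integrable P (fun w => f w * \1_E w).
Proof.
move=> mE sf; have [mf _] := sf; apply: (sq_integrable_le _ sf).
  exact: measurable_funM.
move=> w; rewrite normrM ler_piMr// indicE.
by case: (_ \in _); rewrite ?normr1 ?normr0.
Qed.

Lemma integrable_sqr_indic (f : Omega -> R) (E : set Omega) : measurable E ->
  sq_integrable P f ->
  P.-integrable setT (EFin \o (fun w => f w ^+ 2 * \1_E w)).
Proof.
move=> mE /(sq_integrable_indic mE)[_]; congr (_.-integrable _ _).
apply/funext => w /=; congr EFin; rewrite exprMn indicE.
by case: (_ \in _); rewrite ?expr1n ?expr0n.
Qed.

(** Expansion of the square after a step [x - y] independent of [g] on [E]: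
[x] and [y] enter only through their means [mx], [my] and their second moments
[Sx], [Sy], which is what the four integral hypotheses express. The second
moment of the difference is bounded by twice the sum of the second moments. *)
Lemma integral_sqr_step (g x y : Omega -> R) (E : set Omega)
    (mx my Sx Sy : R) : measurable E ->
  sq_integrable P g -> sq_integrable P x -> sq_integrable P y ->
  \int[P]_w (g w * \1_E w * x w) = (\int[P]_w (g w * \1_E w)) * mx ->
  \int[P]_w (g w * \1_E w * y w) = (\int[P]_w (g w * \1_E w)) * my ->
  \int[P]_w (x w ^+ 2 * \1_E w) = Sx * fine (P E) ->
  \int[P]_w (y w ^+ 2 * \1_E w) = Sy * fine (P E) ->
  \int[P]_w ((g w - (x w - y w)) ^+ 2 * \1_E w) <=
    \int[P]_w (g w ^+ 2 * \1_E w) - 2 * (mx - my) * \int[P]_w (g w * \1_E w)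
    + 2 * (Sx + Sy) * fine (P E).
Proof.
move=> mE sg sx sy gx gy xx yy.
have sgE := sq_integrable_indic mE sg.
have s1 : sq_integrable P (fun w => \1_E w).
  have := sq_integrable_indic mE (sq_integrable_cst 1).
  by under eq_fun do rewrite mul1r.
have sq_int u : sq_integrable P u -> P.-integrable setT
    (EFin \o (fun w => u w ^+ 2 * \1_E w)) by exact: integrable_sqr_indic.
have IgEx : P.-integrable setT (EFin \o (fun w => g w * \1_E w * x w)).
  exact: sq_integrableM.
have IgEy : P.-integrable setT (EFin \o (fun w => g w * \1_E w * y w)).
  exact: sq_integrableM.
have If : P.-integrable setT (EFin \o (fun w => g w ^+ 2 * \1_E w +
   ((-2) * (g w * \1_E w * x w) + 2 * (g w * \1_E w * y w)))).
  apply: integrable_addR => //; first exact: sq_int.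
  by apply: integrable_addR => //; exact: integrable_scaleR.
have Ih : P.-integrable setT (EFin \o (fun w =>
   2 * (x w ^+ 2 * \1_E w) + 2 * (y w ^+ 2 * \1_E w))).
  by apply: integrable_addR => //; apply: integrable_scaleR => //; exact: sq_int.
rewrite -mulrA [_ * (_ + _)]mulrDr.
have step : \int[P]_w ((g w - (x w - y w)) ^+ 2 * \1_E w) <=
    \int[P]_w ((g w ^+ 2 * \1_E w +
   ((-2) * (g w * \1_E w * x w) + 2 * (g w * \1_E w * y w))) +
   (2 * (x w ^+ 2 * \1_E w) + 2 * (y w ^+ 2 * \1_E w))).
  apply: le_Rintegral => //.
  - apply: sq_int; apply: (@sq_integrableD g (fun w => - (x w - y w))) => //.
    have sxy : sq_integrable P (fun w => x w + (-1) * y w).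
      apply: sq_integrableD => //; apply: (sq_integrable_le _ sy).
        by apply: measurable_funM => //; case: (sy).
      by move=> w; rewrite mulN1r normrN.
    apply: (sq_integrable_le _ sxy).
      by apply: measurable_funN; apply: measurable_funB; [case: sx|case: sy].
    by move=> w; rewrite normrN mulN1r.
  - exact: integrable_addR.
  - move=> w _; have h1 := sqr_ge0 (x w + y w).
    by rewrite indicE; case: (_ \in _); rewrite ?mulr0 ?mulr1 ?mul0r; nra.
apply: le_trans step _.
rewrite RintegralD// RintegralD//; last 2 first.
  - exact: sq_int.
  - by apply: integrable_addR => //; exact: integrable_scaleR.
rewrite RintegralD//; try exact: integrable_scaleR.
rewrite RintegralZl// RintegralZl// gx gy.
rewrite RintegralD//; try by apply: integrable_scaleR => //; exact: sq_int.
rewrite RintegralZl//; last exact: sq_int.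
rewrite RintegralZl//; last exact: sq_int.
rewrite xx yy; lra.
Qed.

End drift_step.

(** * Walks driven by independent streams *)

Section streams.
Context {R : realType} {K : nat} {dO : measure_display}
  {Omega : measurableType dO} {dX : 'I_K -> measure_display}
  {X : forall k, measurableType (dX k)}.
Variable obs : nat -> forall k : 'I_K, Omega -> X k.
Hypothesis mobs : forall s k, measurable_fun setT (obs s k).

Local Notation flat_obs := (fun i : nat * 'I_K => obs i.1 i.2).

(** The generators of [Ffilt obs t], kept apart to form the measurable space
of the observations before [t]. *)
Definition past (t : nat) : set (set Omega) :=
  [set E | exists s k (B : set (X k)),
     [/\ (s < t)%N, measurable B & E = obs s k @^-1` B]].

Definition window (t : nat) : {fset nat * 'I_K} :=
  [fset i in [seq (s, k) | s <- iota 0 t, k <- enum 'I_K]]%fset.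

Lemma in_window t s k : ((s, k) \in window t) = (s < t)%N.
Proof.
rewrite in_fset /=; apply/allpairsP/idP => [[[a b] [/= + _ [-> _]]]|st].
  by rewrite mem_iota.
by exists (s, k); rewrite /= mem_iota mem_enum.
Qed.

Lemma Ffilt_cylinder t : Ffilt obs t `<=` <<s cylinder flat_obs (window t) >>.
Proof.
apply: sub_sigma_algebra2 => E [s [k [B [st mB ->]]]].
apply: (coord_event_cylinder (i := (s, k))); first by rewrite in_window.
by exists B.
Qed.

Lemma Ffilt_measurable t : Ffilt obs t `<=` measurable.
Proof.
apply: (subset_trans (@Ffilt_cylinder t)).
by apply: sigma_cylinder_measurable => i; exact: mobs.
Qed.

Lemma Ffilt_le s t : (s <= t)%N -> Ffilt obs s `<=` Ffilt obs t.
Proof.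
move=> st; apply: sub_sigma_algebra2 => E [u [k [B [us mB ->]]]].
by exists u, k, B; split => //; exact: leq_trans us st.
Qed.

Lemma measurable_obs_past t s k : (s < t)%N ->
  measurable_fun (setT : set (g_sigma_algebraType (past t))) (obs s k).
Proof.
move=> st _ B mB; rewrite setTI; apply: sub_gen_smallest.
by exists s, k, B.
Qed.

Lemma measurable_past (t : nat) (d' : measure_display) (T : measurableType d')
    (g : Omega -> T) :
  measurable_fun (setT : set (g_sigma_algebraType (past t))) g ->
  measurable_fun setT g.
Proof.
move=> mg _ B mB; rewrite setTI; apply: (@Ffilt_measurable t).
by have := mg measurableT B mB; rewrite setTI.
Qed.

Section scores.
Variable sc : forall k, X k -> R.
Arguments sc : clear implicits.
Hypothesis msc : forall k, measurable_fun setT (sc k).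

Definition walk (t : nat) (k : 'I_K) (w : Omega) : R :=
  \sum_(s < t) sc k (obs s k w).

Definition gap (t : nat) (p : 'I_K * 'I_K) (w : Omega) : R :=
  walk t p.1 w - walk t p.2 w.

Definition deficit (c : R) (t : nat) (p : 'I_K * 'I_K) (w : Omega) : R :=
  Num.max (c - gap t p w) 0.

Lemma walkS t k w : walk t.+1 k w = walk t k w + sc k (obs t k w).
Proof. by rewrite /walk big_ord_recr. Qed.

Lemma gapS t p w : gap t.+1 p w =
  gap t p w + (sc p.1 (obs t p.1 w) - sc p.2 (obs t p.2 w)).
Proof. by rewrite /gap !walkS; ring. Qed.

Lemma measurable_walk_past t k :
  measurable_fun (setT : set (g_sigma_algebraType (past t))) (walk t k).
Proof.
apply: measurable_sum => s; apply: measurableT_comp => //.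
exact: measurable_obs_past.
Qed.

Lemma measurable_gap_past t p :
  measurable_fun (setT : set (g_sigma_algebraType (past t))) (gap t p).
Proof. by apply: measurable_funB; exact: measurable_walk_past. Qed.

Lemma measurable_deficit_past c t p :
  measurable_fun (setT : set (g_sigma_algebraType (past t))) (deficit c t p).
Proof.
apply: measurable_maxr => //; apply: measurable_funB => //.
exact: measurable_gap_past.
Qed.

Section one_law.
Variable P : probability Omega R.
Hypothesis indep : mutually_independent P flat_obs.

(** The observations numbered [t] are independent of those before [t]. *)
Lemma integral_past_next t k (g : Omega -> R) (h : X k -> R) :
  measurable_fun (setT : set (g_sigma_algebraType (past t))) g ->
  measurable_fun setT h ->
  P.-integrable setT (EFin \o g) ->
  P.-integrable setT (EFin \o (h \o obs t k)) ->
  \int[P]_w (g w * h (obs t k w)) =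
    (\int[P]_w g w) * (\int[P]_w h (obs t k w)).
Proof.
move=> mg mh Ig Ih; have [|_] := integral_independentM Ig Ih.
  move=> A B mA mB.
  apply: (cylinder_independent (Y := flat_obs) _ indep (k := (t, k)) (J := window t)).
  - by move=> i; exact: mobs.
  - by rewrite in_window ltnn.
  - by apply: Ffilt_cylinder; have := mg measurableT A mA; rewrite setTI.
  - exists (h @^-1` B) => //; by rewrite -[X in measurable X]setTI; exact: mh.
rewrite /Rintegral => ->; rewrite fineM//.
  exact: integrable_fin_num Ig.
exact: integrable_fin_num Ih.
Qed.

Variables (mn S2 : 'I_K -> R).
Hypothesis sq_sc : forall s k, sq_integrable P (sc k \o obs s k).
Hypothesis mean_sc : forall s k, \int[P]_w sc k (obs s k w) = mn k.
Hypothesis sq_mean_sc : forall s k, \int[P]_w (sc k (obs s k w)) ^+ 2 = S2 k.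

Lemma sq_integrable_walk t k : sq_integrable P (walk t k).
Proof.
elim: t => [|t IH].
  have := sq_integrable_cst P 0; congr (sq_integrable _ _).
  by apply/funext => w; rewrite /walk big_ord0.
have := sq_integrableD IH (sq_sc t k); congr (sq_integrable _ _).
by apply/funext => w; rewrite walkS.
Qed.

Lemma sq_integrable_deficit c t p : sq_integrable P (deficit c t p).
Proof.
have s1 : sq_integrable P (fun w => c + (- walk t p.1 w + walk t p.2 w)).
  apply: sq_integrableD; first exact: sq_integrable_cst.
  apply: sq_integrableD; last exact: sq_integrable_walk.
  have sw := sq_integrable_walk t p.1.
  apply: (sq_integrable_le _ sw) => [|w]; last by rewrite normrN.
  by apply: measurable_funN; case: sw.
apply: (sq_integrable_le _ s1) => [|w].
  exact: (measurable_past (@measurable_deficit_past c t p)).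
rewrite /deficit /gap opprB addrC [- _ + _]addrC [c + _]addrC.
have [h|h] := leP (walk t p.2 w - walk t p.1 w + c) 0; first by rewrite normr0.
by [].
Qed.

(** The new deficit is the positive part of a number that is at most the old
deficit minus the step, so its square is at most the square of the old deficit
minus the step, to which [integral_sqr_step] applies. *)
Lemma deficit_drift c t p E : Ffilt obs t E ->
  \int[P]_w (deficit c t.+1 p w ^+ 2 * \1_E w) <=
    \int[P]_w (deficit c t p w ^+ 2 * \1_E w)
    - 2 * (mn p.1 - mn p.2) * \int[P]_w (deficit c t p w * \1_E w)
    + 2 * (S2 p.1 + S2 p.2) * fine (P E).
Proof.
move=> FE; have mE := Ffilt_measurable FE.
have sd := sq_integrable_deficit c t p.
have sdE := sq_integrable_indic mE sd.
have mE' : measurable_fun (setT : set (g_sigma_algebraType (past t)))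
    (\1_E : Omega -> R).
  exact: measurable_indic.
have mdE : measurable_fun (setT : set (g_sigma_algebraType (past t)))
    (fun w => deficit c t p w * \1_E w).
  by apply: measurable_funM => //; exact: measurable_deficit_past.
have IE : P.-integrable setT (EFin \o (\1_E : Omega -> R)).
  exact: integrable_indic.
have sqI (f : Omega -> R) : sq_integrable P f -> P.-integrable setT
    (EFin \o (fun w => f w ^+ 2 * \1_E w)) by exact: integrable_sqr_indic.
have nextE k : \int[P]_w (sc k (obs t k w) ^+ 2 * \1_E w) = S2 k * fine (P E).
  rewrite -(sq_mean_sc t) mulrC.
  transitivity (\int[P]_w (\1_E w * (sc k (obs t k w) ^+ 2))).
    by apply: eq_Rintegral => w _; rewrite mulrC.
  rewrite (@integral_past_next t k _ (fun x => sc k x ^+ 2))//.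
  - by congr (_ * _); rewrite /Rintegral integral_indic// setIT.
  - exact: measurable_funX.
  - by have [] := sq_sc t k.
have nextd k : \int[P]_w (deficit c t p w * \1_E w * sc k (obs t k w)) =
    (\int[P]_w (deficit c t p w * \1_E w)) * mn k.
  rewrite -(mean_sc t) (@integral_past_next t k)//.
  - exact: sq_integrable_integrable.
  - exact: sq_integrable_integrable.
apply: (le_trans _ (integral_sqr_step mE sd (sq_sc t p.1) (sq_sc t p.2)
  (nextd _) (nextd _) (nextE _) (nextE _))).
apply: le_Rintegral => //.
- exact/sqI/sq_integrable_deficit.
- apply: sqI.
  have s1 := sq_integrableD sd (sq_sc t p.2).
  have s2 : sq_integrable P (fun w => - sc p.1 (obs t p.1 w)).
    apply: (sq_integrable_le _ (sq_sc t p.1)) => [|w]; last by rewrite normrN.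
    by apply: measurable_funN; case: (sq_sc t p.1).
  have := sq_integrableD s1 s2; congr (sq_integrable _ _).
  by apply/funext => w /=; ring.
- move=> w _; apply: ler_wpM2r; first by rewrite indicE.
  rewrite /deficit gapS /=.
  set u := gap t p w; set x := sc _ _; set y := sc _ _.
  have [h1|h1] := leP (c - (u + (x - y))) 0; first by rewrite expr0n sqr_ge0.
  have [h2|h2] := leP (c - u) 0; last by rewrite opprD addrA.
  by rewrite ler_pXn2r ?nnegrE //; lra.
Qed.

End one_law.
End scores.
End streams.

(** * Counting times and Lyapunov functions *)

Section lyapunov.
Context {R : realType} {d : measure_display} {Omega : measurableType d}.
Variable P : {measure set Omega -> \bar R}.
Local Open Scope ereal_scope.

(** The integral of a nonnegative function is a supremum over the simple
functions below it, hence monotone also on functions that are not known to be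
measurable, such as the time at which a procedure stops. *)
Lemma ge0_le_integralT (f g : Omega -> \bar R) : (forall w, 0 <= f w) ->
  (forall w, f w <= g w) -> \int[P]_w f w <= \int[P]_w g w.
Proof.
move=> f0 fg; rewrite !ge0_integralTE//; last first.
  by move=> w; exact: le_trans (fg w).
apply: le_ereal_sup => _ [h hf <-]; exists h => // w.
exact: le_trans (hf w) (fg w).
Qed.

Lemma sum_prob_le_etime (T : Omega -> option nat) n :
  (forall t, measurable [set w | time_le (T w) t]) ->
  \sum_(t < n) P [set w | ~~ time_le (T w) t] <= \int[P]_w etime (T w).
Proof.
move=> mT.
have mL t : measurable [set w | ~~ time_le (T w) t].
  rewrite (_ : mkset _ = ~` [set w | time_le (T w) t]); first exact: measurableC.
  by apply/seteqP; split => w /= /negP.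
rewrite (eq_bigr (fun t : 'I_n =>
    \int[P]_w (\1_[set w | ~~ time_le (T w) t] w)%:E)); last first.
  by move=> t _; rewrite integral_indic// setIT.
rewrite -ge0_integral_sum//; last first.
  by move=> t; exact/measurable_EFinP/measurable_indic.
apply: ge0_le_integralT => w; first by apply: sume_ge0.
rewrite sumEFin.
have E1 (t : 'I_n) : (\1_[set w | ~~ time_le (T w) t] w =
    (~~ time_le (T w) t)%:R :> R)%R.
  by rewrite indicE; congr (_%:R); congr nat_of_bool; apply/idP/idP; rewrite inE.
rewrite (eq_bigr _ (fun t _ => E1 t)) -natr_sum.
case: (T w) => [k|]; last by rewrite /= leey.
rewrite /= lee_fin ler_nat {E1}.
suff -> : (\sum_(t < n) ~~ (k <= t) = minn n k)%N by exact: geq_minr.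
elim: n => [|n IH]; first by rewrite big_ord0 min0n.
by rewrite big_ord_recr /= IH; case: (leqP k n) => h; lia.
Qed.

Lemma etime_le_nneseries (T : Omega -> option nat) (G : nat -> set Omega) :
  (forall t, measurable (G t)) ->
  (forall w t, ~~ time_le (T w) t -> G t w) ->
  \int[P]_w etime (T w) <= \sum_(t <oo) P (G t).
Proof.
move=> mG TG.
rewrite (eq_eseriesr (g := fun t => \int[P]_w (\1_(G t) w)%:E)); last first.
  by move=> t _; rewrite integral_indic// setIT.
rewrite -integral_nneseries//; last first.
  by move=> t; exact/measurable_EFinP/measurable_indic.
apply: ge0_le_integralT => w; first by case: (T w) => [k|] /=; rewrite ?lee_fin.
have part n : (forall t, (t < n)%N -> ~~ time_le (T w) t) ->
    n%:R%:E <= \sum_(t <oo) (\1_(G t) w)%:E :> \bar R.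
  move=> nT; apply: (@le_trans _ _ (\sum_(0 <= t < n) (\1_(G t) w)%:E)).
    rewrite big_mkord (eq_bigr (fun=> 1%:E)); last first.
      by move=> t _; rewrite indicE mem_set//; apply: TG; exact: nT.
    by rewrite sumEFin sumr_const card_ord.
  by apply: nneseries_lim_ge => t _; rewrite lee_fin.
case Tw : (T w) => [k|] /=.
  by apply: part => t tk; rewrite Tw /= -ltnNge.
rewrite leye_eq; apply/eqP/eq_infty => r.
apply: (@le_trans _ _ (Num.bound `|r|%R)%:R%:E).
  by rewrite lee_fin ltW// (le_lt_trans (ler_norm r))// archi_boundP// normr_ge0.
by apply: part => t _; rewrite Tw.
Qed.

(** [N t] is the event that the target is not yet reached at time [t] and [L t]
the event that the clock has started, so the left-hand side is the expected
time between the start of the clock and the target, truncated at [n]. Each step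
spent in [N t `&` L t] costs one unit of the mean of [V], and this mean is fed
only by the values of [V] at the moments when the clock starts. *)
Lemma lyapunov_sum (V : nat -> Omega -> R) (N L : nat -> set Omega) :
  (forall t, measurable_fun setT (V t)) -> (forall t w, (0 <= V t w)%R) ->
  (forall t, measurable (N t)) -> (forall t, measurable (L t)) ->
  (forall t, N t.+1 `<=` N t) -> (forall t, L t `<=` L t.+1) ->
  L 0%N = set0 ->
  (forall t, \int[P]_(w in N t `&` L t) (V t.+1 w)%:E + P (N t `&` L t) <=
    \int[P]_(w in N t `&` L t) (V t w)%:E) ->
  forall n, \sum_(t < n) P (N t `&` L t) <=
    \sum_(t < n) \int[P]_(w in L t.+1 `\` L t) (V t.+1 w)%:E.
Proof.
move=> mV V0 mN mL decN incL L0 drift n.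
have mVE t A : measurable_fun A (EFin \o V t).
  exact/measurable_funTS/measurable_EFinP.
suff : \int[P]_(w in N n `&` L n) (V n w)%:E + \sum_(t < n) P (N t `&` L t) <=
    \sum_(t < n) \int[P]_(w in L t.+1 `\` L t) (V t.+1 w)%:E.
  by apply: le_trans; rewrite leeDr// integral_ge0// => w _; rewrite lee_fin.
elim: n => [|n IH].
  by rewrite !big_ord0 adde0 L0 setI0 integral_set0.
rewrite [in leLHS]big_ord_recr [in leRHS]big_ord_recr/=.
apply: (@le_trans _ _ ((\int[P]_(w in N n `&` L n) (V n.+1 w)%:E +
    \int[P]_(w in L n.+1 `\` L n) (V n.+1 w)%:E) +
    (\sum_(t < n) P (N t `&` L t) + P (N n `&` L n)))).
  apply: leeD => //; rewrite -ge0_integral_setU//.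
  - apply: ge0_subset_integral.
    + by apply: measurableI.
    + by apply: measurableU; [apply: measurableI|apply: measurableD].
    + exact: mVE.
    + by move=> w _; rewrite lee_fin.
    + move=> w [Nw Lw]; have [Lnw|Lnw] := pselect (L n w); last by right.
      by left; split => //; exact: decN.
  - exact: measurableI.
  - exact: measurableD.
  - exact: mVE.
  - by move=> w _; rewrite lee_fin.
  - by apply/disj_setPS => w [[_ Lw] [_]].
rewrite [X in _ + X]addeC addeACA [X in _ + X]addeC addeA.
apply: leeD => //; apply: le_trans IH.
by apply: leeD => //; exact: drift.
Qed.

End lyapunov.

(** * Quadratic Lyapunov function of the gaps *)

Section lyapunov_drift.
Context {R : realType} {K : nat} {dO : measure_display}
  {Omega : measurableType dO} {dX : 'I_K -> measure_display}
  {X : forall k, measurableType (dX k)}.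
Variable obs : nat -> forall k : 'I_K, Omega -> X k.
Hypothesis mobs : forall s k, measurable_fun setT (obs s k).
Variable sc : forall k, X k -> R.
Arguments sc : clear implicits.
Hypothesis msc : forall k, measurable_fun setT (sc k).
Variable A : {set 'I_K}.

Definition separating (p : 'I_K * 'I_K) : bool := (p.1 \in A) && (p.2 \notin A).

Definition lyapunov (c : R) (t : nat) (w : Omega) : R :=
  \sum_(p | separating p) deficit obs sc c t p w ^+ 2.

Definition gaps_above (b : R) (t : nat) (w : Omega) : bool :=
  [forall p, separating p ==> (b <= gap obs sc t p w)].

Lemma measurable_lyapunov c t : measurable_fun setT (lyapunov c t).
Proof.
rewrite /lyapunov; under eq_fun do rewrite -big_filter.
apply: measurable_sum => p; apply: measurable_funX.
exact: (measurable_past mobs (@measurable_deficit_past _ _ _ _ _ _ _ _ msc c t p)).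
Qed.

Lemma lyapunov_ge0 c t w : 0 <= lyapunov c t w.
Proof. by apply: sumr_ge0 => p _; exact: sqr_ge0. Qed.

Variable P : probability Omega R.
Hypothesis indep :
  mutually_independent P (fun i : nat * 'I_K => obs i.1 i.2).
Variables (mn S2 : 'I_K -> R).
Hypothesis sq_sc : forall s k, sq_integrable P (sc k \o obs s k).
Hypothesis mean_sc : forall s k, \int[P]_w sc k (obs s k w) = mn k.
Hypothesis sq_mean_sc : forall s k, \int[P]_w (sc k (obs s k w)) ^+ 2 = S2 k.

Lemma integral_mul_indic (f : Omega -> R) E : measurable E ->
  P.-integrable setT (EFin \o f) ->
  (\int[P]_(w in E) (f w)%:E)%E = (\int[P]_w (f w * \1_E w))%:E.
Proof.
move=> mE If; rewrite /Rintegral fineK.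
  rewrite [LHS]integral_mkcond; apply: eq_integral => w _.
  by rewrite epatch_indic.
apply: integrable_fin_num => //.
apply: (@integrable_dominated _ _ _ _ _ (fun w => `|f w|)).
- by apply: measurable_funM => //; exact/measurable_EFinP/(measurable_int _ If).
- exact: (integrable_abse If).
- move=> w; rewrite normrM ler_piMr// indicE.
  by case: (_ \in _); rewrite ?normr1 ?normr0.
Qed.

Lemma integral_sum_separating (F : 'I_K * 'I_K -> Omega -> R) E :
  measurable E -> (forall p w, 0 <= F p w) ->
  (forall p, P.-integrable setT (EFin \o F p)) ->
  (\int[P]_(w in E) (\sum_(p | separating p) F p w)%:E)%E =
  (\sum_(p | separating p) \int[P]_w (F p w * \1_E w))%:E.
Proof.
move=> mE F0 IF.
under eq_integral do rewrite -sumEFin -big_filter.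
rewrite ge0_integral_sum//; last 2 first.
- by move=> p; apply/measurable_funTS/(measurable_int _ (IF p)).
- by move=> p w _; rewrite lee_fin.
rewrite big_filter -sumEFin; apply: eq_bigr => p _.
exact: integral_mul_indic.
Qed.

(** While some gap is below [b], its deficit from the level [b + M] is at least
[M], so per unit of the probability of [E] the linear terms of the expansion of
the squares are at most [- 2 * dmin * M]. By the choice of [M] this outweighs
the second moments of the steps by one. *)
Lemma lyapunov_drift (b M dmin : R) t E :
  Ffilt obs t E -> E `<=` [set w | ~~ gaps_above b t w] ->
  0 <= dmin -> 0 <= M ->
  (forall p, separating p -> dmin <= mn p.1 - mn p.2) ->
  \sum_(p | separating p) 2 * (S2 p.1 + S2 p.2) + 1 <= 2 * dmin * M ->
  (\int[P]_(w in E) (lyapunov (b + M) t.+1 w)%:E + P E <=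
   \int[P]_(w in E) (lyapunov (b + M) t w)%:E)%E.
Proof.
move=> FE Eb d0 M0 dminE ME.
have mE : measurable E := Ffilt_measurable mobs FE.
have sd u p := sq_integrable_deficit mobs msc sq_sc (b + M) u p.
have df0 p w : 0 <= deficit obs sc (b + M) t p w by rewrite /deficit le_max lexx orbT.
rewrite /lyapunov !integral_sum_separating//; last 4 first.
- by move=> p w; exact: sqr_ge0.
- by move=> p; case: (sd t p).
- by move=> p w; exact: sqr_ge0.
- by move=> p; case: (sd t.+1 p).
have PE : P E = (fine (P E))%:E by rewrite fineK// fin_num_measure.
rewrite PE -EFinD lee_fin.
have total : M * fine (P E) <= \sum_(p | separating p)
    \int[P]_w (deficit obs sc (b + M) t p w * \1_E w).
  rewrite -lee_fin EFinM -PE -integral_sum_separating//; last first.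
    by move=> p; exact: sq_integrable_integrable.
  rewrite -integral_cst//; apply: ge0_le_integral => //.
    apply/measurable_funTS/measurable_EFinP.
    under eq_fun do rewrite -big_filter.
    by apply: measurable_sum => p; case: (sd t p).
  move=> w /Eb /=; rewrite /gaps_above negb_forall => /existsP[p].
  rewrite negb_imply -ltNge => /andP[sp gp].
  rewrite lee_fin (bigD1 p)//= -[leLHS]addr0; apply: lerD.
    by rewrite /deficit le_max; apply/orP; left; lra.
  by apply: sumr_ge0 => q _.
apply: (@le_trans _ _ (\sum_(p | separating p)
   (\int[P]_w (deficit obs sc (b + M) t p w ^+ 2 * \1_E w)
    - 2 * dmin * \int[P]_w (deficit obs sc (b + M) t p w * \1_E w)
    + 2 * (S2 p.1 + S2 p.2) * fine (P E)) + fine (P E))).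
  rewrite lerD2r; apply: ler_sum => p sp.
  apply: (le_trans (deficit_drift mobs msc indep sq_sc mean_sc sq_mean_sc
    (b + M) p FE)).
  rewrite lerD2r lerD2l lerN2; apply: ler_wpM2r.
    apply: Rintegral_ge0 => w _; apply: mulr_ge0; first exact: df0.
    by rewrite indicE.
  by rewrite ler_pM2l//; exact: dminE.
rewrite !big_split/= sumrN -mulr_sumr -mulr_suml.
set s := \sum_(p | _) \int[P]_w (_ * _) in total *.
have P0 : 0 <= fine (P E) by apply: fine_ge0.
rewrite -addrA -addrA gerDl.
have h1 : 2 * dmin * (M * fine (P E)) <= 2 * dmin * s.
  by apply: ler_wpM2l => //; apply: mulr_ge0.
have h2 : (\sum_(p | separating p) 2 * (S2 p.1 + S2 p.2) + 1) * fine (P E) <=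
    2 * dmin * M * fine (P E) by apply: ler_wpM2r.
move: h1 h2; rewrite mulrDl mul1r !mulrA; lra.
Qed.

End lyapunov_drift.

(** * Excess of the separation time over a competing procedure *)

Section excess.
Context {R : realType} {K : nat} {dO : measure_display}
  {Omega : measurableType dO} {dX : 'I_K -> measure_display}
  {X : forall k, measurableType (dX k)}.
Variable obs : nat -> forall k : 'I_K, Omega -> X k.
Hypothesis mobs : forall s k, measurable_fun setT (obs s k).
Variable sc : forall k, X k -> R.
Arguments sc : clear implicits.
Hypothesis msc : forall k, measurable_fun setT (sc k).
Variable A : {set 'I_K}.

(** Square [u / 2 <= expR (u / 2)]. *)
Lemma sqr_le_expR (u : R) : 0 <= u -> u ^+ 2 <= 4 * expR u.
Proof.
move=> u0; have h1 := expR_ge1Dx (u / 2).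
have -> : expR u = expR (u / 2) ^+ 2.
  by rewrite -expRM_natl; congr expR; field.
have : (u / 2) ^+ 2 <= expR (u / 2) ^+ 2.
  by rewrite ler_pXn2r ?nnegrE ?expR_ge0 ?divr_ge0//; lra.
rewrite expr_div_n; lra.
Qed.

(** Used where the decision is the true set: the change of law by the
exponential of the gap makes this decision an error. *)
Lemma deficit_le_expR c t p w : deficit obs sc c t p w ^+ 2 <=
  4 * expR c * expR (- gap obs sc t p w).
Proof.
rewrite -mulrA -expRD /deficit; case: (leP (c - gap obs sc t p w) 0) => [_|h].
  by rewrite expr0n mulr_ge0// expR_ge0.
by apply: sqr_le_expR; exact: ltW.
Qed.

(** Used where the decision is wrong: the first term is multiplied by a
probability of error, and the second is a likelihood ratio without the large
factor [expR c]. *)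
Lemma deficit_le_cst c t p w : deficit obs sc c t p w ^+ 2 <=
  2 * c ^+ 2 + 8 * expR (- gap obs sc t p w).
Proof.
rewrite /deficit; set g := gap _ _ _ _ _.
have e0 := expR_gt0 (- g); have c2 := sqr_ge0 c.
case: (leP (c - g) 0) => [_|h]; first by rewrite expr0n/=; lra.
have [g0|g0] := leP 0 g.
  have : (c - g) ^+ 2 <= c ^+ 2 by rewrite ler_pXn2r ?nnegrE//; lra.
  lra.
have : (- g) ^+ 2 <= 4 * expR (- g) by apply: sqr_le_expR; lra.
have := sqr_ge0 (c + g); nra.
Qed.

(** The increments of an increasing sequence of events are disjoint. *)
Lemma sum_prob_increments_le (mu : {measure set Omega -> \bar R})
    (L : nat -> set Omega) (C : set Omega) n :
  (forall t, measurable (L t)) -> (forall t, L t `<=` L t.+1) ->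
  measurable C ->
  (\sum_(t < n) mu ((L t.+1 `\` L t) `&` C) <= mu C)%E.
Proof.
move=> mL incL mC; apply: (@le_trans _ _ (mu (L n `&` C))); last first.
  by apply: le_measure; rewrite ?inE//; exact: measurableI.
elim: n => [|n IH]; first by rewrite big_ord0.
have -> : L n.+1 `&` C = (L n `&` C) `|` ((L n.+1 `\` L n) `&` C).
  by rewrite -setIUl setDUK//; exact: incL.
rewrite measureU; first by rewrite big_ord_recr /= leeD.
- exact: measurableI.
- by apply: measurableI => //; exact: measurableD.
- by apply/seteqP; split => // w [[Lw _] [[_]]].
Qed.

Variables (P : probability Omega R) (Q : 'I_K * 'I_K -> probability Omega R).
Hypothesis change : forall p, separating A p -> forall t E, Ffilt obs t E ->
  (\int[P]_(w in E) (expR (- gap obs sc t p w))%:E = Q p E)%E.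

Let msum (F : 'I_K * 'I_K -> Omega -> R) (E : set Omega) :
  (forall p, measurable_fun setT (F p)) ->
  measurable_fun E (fun w => (\sum_(p | separating A p) F p w)%:E).
Proof.
move=> mF; apply/measurable_funTS/measurable_EFinP.
by under eq_fun do rewrite -big_filter; exact: measurable_sum.
Qed.

Let isum (F : 'I_K * 'I_K -> Omega -> R) (E : set Omega) : measurable E ->
  (forall p, measurable_fun setT (F p)) -> (forall p w, 0 <= F p w) ->
  (\int[P]_(w in E) (\sum_(p | separating A p) F p w)%:E =
   \sum_(p | separating A p) \int[P]_(w in E) (F p w)%:E)%E.
Proof.
move=> mE mF F0.
under eq_integral do rewrite -sumEFin -big_filter.
rewrite ge0_integral_sum//; last 2 first.
- by move=> p; apply/measurable_funTS/measurable_EFinP.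
- by move=> p w _; rewrite lee_fin.
by rewrite big_filter.
Qed.

Let mgap t p : measurable_fun setT (fun w => expR (- gap obs sc t p w)).
Proof.
apply: measurableT_comp => //; apply: measurable_funN.
exact: (measurable_past mobs (@measurable_gap_past _ _ _ _ _ _ _ _ msc t p)).
Qed.

Lemma integral_lyapunov_le_expR c t E : Ffilt obs t E ->
  (\int[P]_(w in E) (lyapunov obs sc A c t w)%:E <=
   \sum_(p | separating A p) (4 * expR c)%:E * Q p E)%E.
Proof.
move=> FE; have mE := Ffilt_measurable mobs FE.
apply: (@le_trans _ _ (\int[P]_(w in E)
  (\sum_(p | separating A p) 4 * expR c * expR (- gap obs sc t p w))%:E)%E).
  apply: ge0_le_integral => //.
  - by move=> w _; rewrite lee_fin; exact: lyapunov_ge0.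
  - by apply/measurable_funTS/measurable_EFinP; exact: measurable_lyapunov.
  - by apply: msum => p; exact: measurable_funM.
  - by move=> w _; rewrite lee_fin; apply: ler_sum => p _; exact: deficit_le_expR.
rewrite isum//.
- apply: lee_sum => p sp; under eq_integral do rewrite EFinM.
  rewrite ge0_integralZl//.
  + by rewrite change.
  + exact/measurable_funTS/measurable_EFinP.
- by move=> p; exact: measurable_funM.
Qed.

Lemma integral_lyapunov_le_cst c t E : Ffilt obs t E ->
  (\int[P]_(w in E) (lyapunov obs sc A c t w)%:E <=
   \sum_(p | separating A p) ((2 * c ^+ 2)%:E * P E + 8%:E * Q p E))%E.
Proof.
move=> FE; have mE := Ffilt_measurable mobs FE.
have c2 : 0 <= 2 * c ^+ 2 by rewrite mulr_ge0// sqr_ge0.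
apply: (@le_trans _ _ (\int[P]_(w in E)
  (\sum_(p | separating A p) (2 * c ^+ 2 + 8 * expR (- gap obs sc t p w)))%:E)%E).
  apply: ge0_le_integral => //.
  - by move=> w _; rewrite lee_fin; exact: lyapunov_ge0.
  - by apply/measurable_funTS/measurable_EFinP; exact: measurable_lyapunov.
  - by apply: msum => p; apply: measurable_funD => //; exact: measurable_funM.
  - by move=> w _; rewrite lee_fin; apply: ler_sum => p _; exact: deficit_le_cst.
rewrite isum//.
- apply: lee_sum => p sp; under eq_integral do rewrite EFinD EFinM.
  rewrite ge0_integralD//.
  + rewrite -EFinM integral_cst//; under eq_integral do rewrite EFinM.
    rewrite ge0_integralZl//.
    * by rewrite change.
    * exact/measurable_funTS/measurable_EFinP.
  + by apply/measurable_funTS/measurable_EFinP; exact: measurable_funM.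
- by move=> p; apply: measurable_funD => //; exact: measurable_funM.
- by move=> p w; rewrite addr_ge0// mulr_ge0// expR_ge0.
Qed.

(** Time 0 is excluded, as procedures take at least one observation. *)
Definition gap_below (b : R) (t : nat) : set Omega :=
  [set w | forall s, (0 < s <= t)%N -> ~~ gaps_above obs sc A b s w].

Lemma FfiltD t E F : Ffilt obs t E -> Ffilt obs t F -> Ffilt obs t (E `\` F).
Proof.
move=> FE FF.
exact: (@measurableD _ (g_sigma_algebraType (past obs t)) _ _ FE FF).
Qed.

Lemma Ffilt_gaps_above b t :
  Ffilt obs t [set w | gaps_above obs sc A b t w].
Proof.
rewrite (_ : mkset _ = \bigcap_(p in [set p | separating A p])
    [set w | b <= gap obs sc t p w]).
  apply: (@fin_bigcap_measurable _ (g_sigma_algebraType (past obs t))) => // p _.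
  rewrite -[X in measurable X]setTI.
  have := @measurable_fun_ler _ (g_sigma_algebraType (past obs t)) R setT (cst b)
    (gap obs sc t p) (measurable_cst _) (@measurable_gap_past _ _ _ _ _ _ _ _ msc t p).
  by move=> /(_ measurableT [set true]); apply.
apply/seteqP; split => w /= => [/forallP sw p /= sp|sw].
  by have := sw p; rewrite sp.
by apply/forallP => p; apply/implyP => sp; exact: sw.
Qed.

Lemma gap_belowS b t : gap_below b t.+1 =
  gap_below b t `&` ~` [set w | gaps_above obs sc A b t.+1 w].
Proof.
apply/seteqP; split => w /=.
  move=> h; split; last by apply/negP; apply: h; rewrite ltnS leqnn.
  by move=> s /andP[s0 st]; apply: h; rewrite s0 leqW.
move=> [h /negP ht] s /andP[s0]; rewrite leq_eqVlt => /orP[/eqP->//|st].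
by apply: h; rewrite s0.
Qed.

Lemma Ffilt_gap_below b t : Ffilt obs t (gap_below b t).
Proof.
elim: t => [|t IH].
  rewrite (_ : gap_below b 0 = setT).
    exact: (@measurableT _ (g_sigma_algebraType (past obs 0))).
  apply/seteqP; split => // w _ s /andP[s0 s1].
  by have := leq_trans s0 s1.
rewrite gap_belowS.
apply: (@measurableI _ (g_sigma_algebraType (past obs t.+1))).
  exact: Ffilt_le IH.
apply: (@measurableC _ (g_sigma_algebraType (past obs t.+1))).
exact: Ffilt_gaps_above.
Qed.

Variables (T : Omega -> option nat) (D : Omega -> {set 'I_K}).
Hypothesis stopT : stopping_time obs T.
Hypothesis FstopD : forall B : {set 'I_K}, Fstop obs T [set w | D w = B].

Definition stopped (t : nat) : set Omega := [set w | time_le (T w) t].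

Lemma stopped0 : stopped 0 = set0.
Proof. by apply/seteqP; split => // w /= h; have [/(_ w)] := stopT; rewrite h. Qed.

Lemma Ffilt_stopped t : Ffilt obs t (stopped t).
Proof.
case: t => [|t]; last by have [_] := stopT; apply.
rewrite stopped0; exact: (@measurable0 _ (g_sigma_algebraType (past obs 0))).
Qed.

Lemma stopped_le t : stopped t `<=` stopped t.+1.
Proof. by move=> w; rewrite /stopped /=; case: (T w) => //= k /leqW. Qed.

Lemma measurable_decision B : measurable [set w | D w = B].
Proof.
have [+ _] := FstopD B; apply: smallest_sub; last first.
  by move=> E [t _]; exact: Ffilt_measurable.
exact: sigma_algebra_measurable.
Qed.

Lemma Ffilt_stop_decision t B :
  Ffilt obs t.+1 ((stopped t.+1 `\` stopped t) `&` [set w | D w = B]).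
Proof.
rewrite setDE setIAC -setDE; apply: FfiltD.
  by rewrite setIC; have [_] := FstopD B; apply.
exact: (Ffilt_le (leqnSn t) (@Ffilt_stopped t)).
Qed.

Lemma Ffilt_stop_decisionC t B :
  Ffilt obs t.+1 ((stopped t.+1 `\` stopped t) `&` ~` [set w | D w = B]).
Proof.
rewrite -[X in Ffilt _ _ X]setDE (_ : _ `\` _ = (stopped t.+1 `\` stopped t) `\`
    ((stopped t.+1 `\` stopped t) `&` [set w | D w = B])).
  apply: FfiltD; last first.
    exact: Ffilt_stop_decision.
  apply: FfiltD.
    exact: Ffilt_stopped.
  exact: (Ffilt_le (leqnSn t) (@Ffilt_stopped t)).
by rewrite setDIr setDv set0U.
Qed.

Variables (mn S2 : 'I_K -> R).
Hypothesis indep :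
  mutually_independent P (fun i : nat * 'I_K => obs i.1 i.2).
Hypothesis sq_sc : forall s k, sq_integrable P (sc k \o obs s k).
Hypothesis mean_sc : forall s k, \int[P]_w sc k (obs s k w) = mn k.
Hypothesis sq_mean_sc : forall s k, \int[P]_w (sc k (obs s k w)) ^+ 2 = S2 k.

(** The left-hand side is the expected time from the stopping time [T] until
all gaps are above [b], truncated at [n]. It is bounded by the mean of the
Lyapunov function at time [T], which is split according to whether the decision
[D] is the true set [A]; the changes of law turn the exponentials of the gaps
into probabilities under the laws [Q p], for which the decision [A] is an
error. *)
Lemma excess_bound (b M dmin alpha : R) n :
  0 <= dmin -> 0 <= M ->
  (forall p, separating A p -> dmin <= mn p.1 - mn p.2) ->
  \sum_(p | separating A p) 2 * (S2 p.1 + S2 p.2) + 1 <= 2 * dmin * M ->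
  (P (~` [set w | D w = A]) <= alpha%:E)%E ->
  (forall p, separating A p -> (Q p [set w | D w = A] <= alpha%:E)%E) ->
  (\sum_(t < n) P (gap_below b t `&` stopped t) <=
   \sum_(p | separating A p)
     (4 * expR (b + M) * alpha + (2 * (b + M) ^+ 2 * alpha + 8))%:E)%E.
Proof.
move=> d0 M0 dminE ME errP errQ; set c := b + M.
have mN t : measurable (gap_below b t).
  by apply: (Ffilt_measurable mobs); exact: Ffilt_gap_below.
have mL t : measurable (stopped t).
  by apply: (Ffilt_measurable mobs); exact: Ffilt_stopped.
have mD := measurable_decision A.
apply: le_trans.
  apply: (@lyapunov_sum _ _ _ P (lyapunov obs sc A c) (gap_below b) stopped) => //.
  - by move=> t; exact: measurable_lyapunov.
  - by move=> t w; exact: lyapunov_ge0.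
  - by move=> t; rewrite gap_belowS => w [].
  - exact: stopped_le.
  - exact: stopped0.
  - move=> t; apply: (lyapunov_drift mobs msc indep sq_sc mean_sc sq_mean_sc
      _ _ d0 M0 dminE ME).
    + apply: (@measurableI _ (g_sigma_algebraType (past obs t))).
        exact: Ffilt_gap_below.
      exact: Ffilt_stopped.
    + case: t => [|t] w; first by rewrite stopped0 => -[].
      by move=> [h _]; apply: h; rewrite ltnS leqnn.
pose U t := stopped t.+1 `\` stopped t.
have mU t : measurable (U t) by exact: measurableD.
apply: (@le_trans _ _ (\sum_(t < n)
    (\sum_(p | separating A p) (4 * expR c)%:E * Q p (U t `&` [set w | D w = A]) +
     \sum_(p | separating A p) ((2 * c ^+ 2)%:E * P (U t `&` ~` [set w | D w = A])
       + 8%:E * Q p (U t `&` ~` [set w | D w = A]))))%E).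
  apply: lee_sum => t _.
  rewrite -/(U t) {1}(_ : U t = (U t `&` [set w | D w = A]) `|`
     (U t `&` ~` [set w | D w = A])); last by rewrite -setIUr setUv setIT.
  rewrite ge0_integral_setU//.
  - apply: leeD.
      by apply: integral_lyapunov_le_expR; exact: Ffilt_stop_decision.
    by apply: integral_lyapunov_le_cst; exact: Ffilt_stop_decisionC.
  - by apply: measurableI.
  - by apply: measurableI => //; exact: measurableC.
  - by apply/measurable_funTS/measurable_EFinP; exact: measurable_lyapunov.
  - by move=> w _; rewrite lee_fin; exact: lyapunov_ge0.
  - by apply/disj_setPS => w [[_ h] [_]].
rewrite big_split /= exchange_big /= [X in (_ + X)%E]exchange_big /= -big_split /=.
apply: lee_sum => p sp.
have e0 : 0 <= 4 * expR c by rewrite mulr_ge0// expR_ge0.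
have c0 : 0 <= 2 * c ^+ 2 by rewrite mulr_ge0// sqr_ge0.
rewrite big_split /= -!ge0_sume_distrr//.
rewrite !EFinD !(EFinM _ alpha); apply: leeD; last apply: leeD.
- apply: lee_wpmul2l; first by rewrite lee_fin.
  apply: le_trans (errQ p sp).
  exact: (sum_prob_increments_le _ _ mL stopped_le).
- apply: lee_wpmul2l; first by rewrite lee_fin.
  apply: le_trans errP; apply: (sum_prob_increments_le _ _ mL stopped_le).
  exact: measurableC.
- rewrite -[leRHS]mule1; apply: lee_wpmul2l; first by rewrite lee_fin.
  apply: (@le_trans _ _ (Q p (~` [set w | D w = A]))).
    by apply: (sum_prob_increments_le _ _ mL stopped_le); exact: measurableC.
  by apply: probability_le1; exact: measurableC.
Qed.

End excess.

(** * Order statistics and the gap rule *)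

Section sorted_counting.
Context {disp : Order.disp_t} {T : orderType disp}.
Implicit Types (s : seq T) (a : T).

(** If the entry at [n] were below [a], so would be the first [n.+1] entries,
and too few entries would remain above [a]. *)
Lemma le_nth_sorted x0 s a n : sorted <=%O s -> (n < size s)%N ->
  (size s - n <= count (>= a)%O s)%N -> (a <= nth x0 s n)%O.
Proof.
move=> ss ns; apply: contraTT; rewrite -ltNge -ltnNge => an.
rewrite -{1}(cat_take_drop n.+1 s) count_cat.
have -> : count (>= a)%O (take n.+1 s) = 0%N.
  apply/eqP; rewrite -leqn0 leqNgt -has_count; apply/hasPn => x.
  move=> /(nthP x0)[i]; rewrite size_takel// => ni <-.
  rewrite nth_take//= -ltNge; apply: le_lt_trans an.
  apply: (sorted_leq_nth le_trans) => //; rewrite inE; exact: leq_trans ni ns.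
rewrite add0n; apply: leq_ltn_trans (count_size _ _) _.
by rewrite size_drop subnS prednK ?subn_gt0.
Qed.

Lemma nth_sorted_le x0 s a n : sorted <=%O s -> (n < size s)%N ->
  (n < count (<= a)%O s)%N -> (nth x0 s n <= a)%O.
Proof.
move=> ss ns; apply: contraTT; rewrite -ltNge -leqNgt => an.
rewrite -{1}(cat_take_drop n s) count_cat.
have -> : count (<= a)%O (drop n s) = 0%N.
  apply/eqP; rewrite -leqn0 leqNgt -has_count; apply/hasPn => x.
  move=> /(nthP x0)[i]; rewrite size_drop => ni <-.
  rewrite nth_drop/= -ltNge; apply: lt_le_trans an _.
  by apply: (sorted_leq_nth le_trans) => //; rewrite ?inE ?leq_addr// -ltn_subRL.
rewrite addn0; apply: leq_trans (count_size _ _) _.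
by rewrite size_takel// ltnW.
Qed.

End sorted_counting.

Section gap_rule.
Context {R : realType} {K : nat} {dO : measure_display}
  {Omega : measurableType dO} {dX : 'I_K -> measure_display}
  {X : forall k, measurableType (dX k)}.
Variables (f : bool -> forall k, X k -> R)
  (obs : nat -> forall k : 'I_K, Omega -> X k).
Variable sc : forall k, X k -> R.
Arguments sc : clear implicits.
Arguments f : clear implicits.

Lemma first_time_le (p : pred nat) t : p t -> time_le (first_time p) t.
Proof.
move=> pt; rewrite /first_time; case: pselect => [ex_p|[]]; last by exists t.
by rewrite /=; case: ex_minnP => n _; apply.
Qed.

(** The [m] ratios of the signals are at least their minimum and the [K - m]
others at most their maximum. By counting, these two numbers are separated by
the [m]-th largest ratio from above and the next one from below, and their
difference is the gap of a separating pair. *)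
Lemma gaps_above_TG (A : {set 'I_K}) (m : nat) (b : R) (t : nat) (w : Omega) :
  (0 < t)%N -> #|A| = m -> (1 <= m)%N -> (m < K)%N ->
  (forall k, llr f obs t k w = (walk obs sc t k w)%:E) ->
  gaps_above obs sc A b t w -> time_le (TG f obs m b w) t.
Proof.
move=> t0 Am m1 mK llrE /forallP gapA; apply: first_time_le; rewrite t0 /=.
have [j1 j1A] : exists j, j \in A by apply/card_gt0P; rewrite Am.
have cardC : #|~: A| = (K - m)%N by have := cardsC A; rewrite Am card_ord; lia.
have [i1 i1A] : exists i, i \in ~: A by apply/card_gt0P; rewrite cardC subn_gt0.
pose v k : \bar R := llr f obs t k w.
have [j0 j0A jmin] := arg_minP (fun k => walk obs sc t k w) j1A.
have [i0 i0A imax] := arg_maxP (fun k => walk obs sc t k w) i1A.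
have {}i0A : i0 \notin A by have : i0 \in ~: A by []; rewrite inE.
set s := [seq v k | k <- ranking f obs t w].
have ss : sorted <=%O s.
  rewrite sorted_map; apply: sort_sorted => x y; exact: le_total.
have sizes : size s = K by rewrite size_map size_sort size_enum_ord.
have counts (p : pred (\bar R)) (B : {set 'I_K}) :
    (forall k, k \in B -> p (v k)) -> (#|B| <= count p s)%N.
  move=> Bp; rewrite count_map.
  have /permP -> : perm_eq (ranking f obs t w) (enum 'I_K) by rewrite perm_sort.
  rewrite cardE -size_filter; apply: uniq_leq_size; first exact: enum_uniq.
  by move=> k; rewrite mem_enum mem_filter mem_enum andbT => /Bp.
rewrite /order_stat -/s.
apply: (@le_trans _ _ (v j0 - v i0)%E).
  rewrite /v !llrE -EFinB lee_fin.
  have := gapA (j0, i0); rewrite /separating /= i0A andbT.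
  by have -> : j0 \in A by [].
apply: leeB.
  rewrite addn1 /=; apply: le_nth_sorted => //; first by rewrite sizes; lia.
  rewrite sizes (_ : (K - (K - m))%N = #|A|) ?Am; last by lia.
  by rewrite -Am; apply: counts => k kA; rewrite /v !llrE lee_fin jmin.
apply: nth_sorted_le => //; first by rewrite sizes; lia.
rewrite prednK ?subn_gt0// -cardC; apply: counts => k kA.
by rewrite /= /v !llrE lee_fin; exact: imax.
Qed.

Lemma llr_walk t k w :
  (forall s, log_ratio (f true k) (f false k) (obs s k w) = (sc k (obs s k w))%:E) ->
  llr f obs t k w = (walk obs sc t k w)%:E.
Proof.
by move=> h; rewrite /llr /walk -sumEFin; apply: eq_bigr => s _; rewrite h.
Qed.

End gap_rule.

(** * Streams whose observations have densities *)

Section constants.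
Context {R : realType}.

Lemma finite_pos_lower_bound (I : finType) (Q : pred I) (F : I -> R) :
  (forall i, Q i -> 0 < F i) ->
  exists2 dmin, 0 < dmin & forall i, Q i -> dmin <= F i.
Proof.
move=> F0; exists (\big[Num.min/1]_(i | Q i) F i).
  by apply: lt_bigmin.
by move=> i Qi; exact: bigmin_le_cond.
Qed.

(** With [N = m * (K - m)], the threshold satisfies [expR b * alpha = N], so
the first term does not depend on [alpha]; the second one is controlled by
[(ln alpha) ^+ 2 * alpha <= 4]. *)
Lemma threshold_bound (N M alpha c : R) : 0 < N -> 0 < alpha -> alpha < 1 ->
  c = `|ln alpha| + ln N + M ->
  4 * expR c * alpha + (2 * c ^+ 2 * alpha + 8) <=
  4 * N * expR M + (4 * (4 + (ln N + M) ^+ 2) + 8).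
Proof.
move=> N0 a0 a1 cdef.
have L0 : ln alpha <= 0 by rewrite ln_le0// ltW.
have cE : c = - ln alpha + (ln N + M) by rewrite cdef ler0_norm// addrA.
have -> : 4 * expR c * alpha = 4 * N * expR M.
  rewrite cE !expRD expRN !lnK ?posrE//.
  by rewrite -!mulrA [N * _]mulrCA mulrA mulrCA; field; lra.
rewrite lerD2l lerD2r.
have h1 : (- ln alpha) ^+ 2 * alpha <= 4.
  have := @sqr_le_expR R (- ln alpha); rewrite oppr_ge0 => /(_ L0) h.
  apply: (@le_trans _ _ (4 * expR (- ln alpha) * alpha)); first by rewrite ler_pM2r.
  by rewrite expRN lnK ?posrE// -mulrA mulVf ?mulr1// gt_eqF.
have h2 : c ^+ 2 <= 2 * (- ln alpha) ^+ 2 + 2 * (ln N + M) ^+ 2.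
  by rewrite cE; have := sqr_ge0 (- ln alpha - (ln N + M)); nra.
have h3 : (ln N + M) ^+ 2 * alpha <= (ln N + M) ^+ 2.
  by rewrite ler_piMr ?sqr_ge0// ltW.
have h4 : c ^+ 2 * alpha <= (2 * (- ln alpha) ^+ 2 + 2 * (ln N + M) ^+ 2) * alpha.
  by rewrite ler_pM2r.
move: h4; rewrite mulrDl => h4; lra.
Qed.

End constants.

Section swap.
Context {K : nat}.

(** The wrong hypothesis closest to [A] along the pair [p]: the signal [p.1] is
replaced by [p.2]. *)
Definition swap (A : {set 'I_K}) (p : 'I_K * 'I_K) : {set 'I_K} :=
  p.2 |: (A :\ p.1).

Lemma card_swap A p : separating A p -> #|swap A p| = #|A|.
Proof.
case: p => j i /andP[/= jA iA]; rewrite /swap cardsU1 /= (cardsD1 j A) jA.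
by rewrite !inE (negbTE iA) andbF.
Qed.

Lemma in_swap A p k : separating A p ->
  (k \in swap A p) = if k == p.1 then false else if k == p.2 then true else k \in A.
Proof.
case: p => j i /andP[/= jA iA]; rewrite /swap !inE /=.
case: (eqVneq k j) => [->|]; last by case: eqVneq.
by rewrite orbF; apply/negbTE; apply: contraNneq iA => <-.
Qed.

Lemma swap_neq A p : separating A p -> swap A p != A.
Proof.
move=> sp; apply/eqP => sA; have := in_swap p.1 sp.
by rewrite eqxx sA; case/andP: sp => ->.
Qed.

End swap.

Section streams_with_densities.
Context {R : realType} {K : nat} {dX : 'I_K -> measure_display}
  {X : forall k : 'I_K, measurableType (dX k)}.
Variables (mu : forall k : 'I_K, {measure set (X k) -> \bar R})
  (f : bool -> forall k : 'I_K, X k -> R).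
Arguments f : clear implicits.
Hypothesis hf : forall (i : bool) (k : 'I_K), is_density (mu k) (f i k).
Context {dO : measure_display} {Omega : measurableType dO}.
Variables (obs : nat -> forall k : 'I_K, Omega -> X k)
  (P : {set 'I_K} -> probability Omega R).
Hypothesis hlaw : streams_law mu f obs P.
Hypothesis hKL : forall (k : 'I_K) (i : bool),
  (0 < \int[mu k]_x (log_ratio (f i k) (f (~~ i) k) x * (f i k x)%:E))%E.
Hypothesis hL2 : forall (k : 'I_K) (i : bool),
  (\int[mu k]_x ((log_ratio (f i k) (f (~~ i) k) x) ^+ 2 * (f i k x)%:E)
     < +oo)%E.

Definition llr_step (k : 'I_K) : X k -> R := score (f true k) (f false k).
Arguments llr_step : clear implicits.

Let mf i k : measurable_fun setT (f i k). Proof. by have [] := hf i k. Qed.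
Let f0 i k x : 0 <= f i k x. Proof. by have [_ ] := hf i k. Qed.
Let mobs s k : measurable_fun setT (obs s k). Proof. by have [] := hlaw. Qed.
Let law B s k C : measurable C ->
  (P B (obs s k @^-1` C) = \int[mu k]_(x in C) (f (k \in B) k x)%:E)%E.
Proof. by have [_ h _] := hlaw; exact: h. Qed.

Arguments mf : clear implicits.
Arguments f0 : clear implicits.
Arguments mobs : clear implicits.
Arguments law : clear implicits.

Let indep B : mutually_independent (P B) (fun i : nat * 'I_K => obs i.1 i.2).
Proof. by have [] := hlaw. Qed.

Lemma measurable_llr_step k : measurable_fun setT (llr_step k).
Proof. exact: measurable_score. Qed.

Lemma ae_same_support i k :
  {ae mu k, forall x, (0 < f i k x) = (0 < f (~~ i) k x)}.
Proof.
have h1 := ae_pos_density (mf i k) (mf (~~ i) k) (f0 i k) (f0 (~~ i) k) (hL2 k i).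
have := hL2 k (~~ i); rewrite negbK => fin2.
have h2 := ae_pos_density (mf (~~ i) k) (mf i k) (f0 (~~ i) k) (f0 i k) fin2.
by apply: filterS2 h1 h2 => x h h'; apply/idP/idP.
Qed.

Let scoreE i k x : score (f i k) (f (~~ i) k) x = (-1) ^+ (~~ i) * llr_step k x.
Proof.
by rewrite /llr_step /score; case: i; rewrite /= ?expr0 ?expr1; ring.
Qed.

Lemma sq_integrable_llr_step B s k : sq_integrable (P B) (llr_step k \o obs s k).
Proof.
have := sq_integrable_score (mf (k \in B) k) (mf (~~ (k \in B)) k)
  (f0 (k \in B) k) (f0 (~~ (k \in B)) k) (ae_same_support (k \in B) k) (mobs s k)
  (law B s k) (hL2 k (k \in B)).
move=> h; apply: (sq_integrable_le _ h) => [|w].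
  by apply: measurableT_comp => //; exact: measurable_llr_step.
by rewrite /= scoreE normrM normrX normrN1 expr1n mul1r.
Qed.

Definition mean_step (B : {set 'I_K}) (k : 'I_K) : R :=
  fine (\int[mu k]_x ((llr_step k x)%:E * (f (k \in B) k x)%:E))%E.

Definition sq_mean_step (B : {set 'I_K}) (k : 'I_K) : R :=
  fine (\int[mu k]_x ((llr_step k x ^+ 2)%:E * (f (k \in B) k x)%:E))%E.

Lemma mean_stepE B s k : \int[P B]_w llr_step k (obs s k w) = mean_step B k.
Proof.
rewrite /Rintegral (integral_law_real (mf _ k) (f0 _ k) (mobs s k) (law B s k))//.
exact: measurable_llr_step.
Qed.

Lemma sq_mean_stepE B s k :
  \int[P B]_w (llr_step k (obs s k w)) ^+ 2 = sq_mean_step B k.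
Proof.
rewrite /Rintegral (integral_law_real (h := fun x => llr_step k x ^+ 2)
  (mf _ k) (f0 _ k) (mobs s k) (law B s k))//.
by apply: measurable_funX; exact: measurable_llr_step.
Qed.

(** Positivity of both Kullback-Leibler divergences of the stream. *)
Lemma mean_step_sign (B : {set 'I_K}) (k : 'I_K) :
  0 < (-1) ^+ (k \notin B) * mean_step B k.
Proof.
have h := integral_score_gt0 (mf (k \in B) k) (mf (~~ (k \in B)) k)
  (f0 (k \in B) k) (f0 (~~ (k \in B)) k) (ae_same_support (k \in B) k) (mobs 0 k)
  (law B 0%N k) (hKL k (k \in B)).
have Ik := sq_integrable_integrable (sq_integrable_llr_step B 0 k).
rewrite -(mean_stepE B 0) -RintegralZl// fine_gt0//.
have -> : (\int[P B]_w ((-1) ^+ (k \notin B) * llr_step k (obs 0 k w))%:E =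
   \int[P B]_w (score (f (k \in B) k) (f (~~ (k \in B)) k) (obs 0 k w))%:E)%E.
  by apply: eq_integral => w _; rewrite scoreE.
rewrite h /= -ge0_fin_numE ?ltW//.
apply: integrable_fin_num => //.
have := integrable_scaleR ((-1) ^+ (k \notin B)) Ik.
by congr (_.-integrable _ _); apply/funext => w /=; rewrite scoreE.
Qed.

Lemma separating_drift B p : separating B p ->
  0 < mean_step B p.1 - mean_step B p.2.
Proof.
move=> /andP[h1 h2]; have := mean_step_sign B p.1; have := mean_step_sign B p.2.
by rewrite h1 h2 expr0 expr1; lra.
Qed.

Lemma prod_window (F : nat * 'I_K -> R) t :
  \prod_(i <- window t) F i = \prod_(s < t) \prod_k F ((s : nat), k).
Proof.
rewrite (perm_big [seq (s, k) | s <- iota 0 t, k <- enum 'I_K]) /=; last first.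
  apply: uniq_perm; first exact: fset_uniq.
    apply: allpairs_uniq; [exact: iota_uniq|exact: enum_uniq|by move=> [? ?] [? ?]].
  by move=> i; rewrite in_fset.
rewrite big_allpairs -[t in iota 0 t]subn0 -/(index_iota 0 t) big_mkord.
by apply: eq_bigr => s _; rewrite big_enum.
Qed.

(** [P A] and [P (swap A p)] differ only in the streams [p.1] and [p.2], with
the two densities exchanged; hence the likelihood ratio of the latter with
respect to the former is the exponential of the difference of two scores,
summed over time. *)
Lemma change_to_swap A p t E : separating A p -> Ffilt obs t E ->
  (\int[P A]_(w in E) (expR (- gap obs llr_step t p w))%:E = P (swap A p) E)%E.
Proof.
move=> sp FE.
have p12 : p.1 != p.2.
  by case/andP: sp => h; apply: contraNneq => <-.
pose e k : R := (k == p.2)%:R - (k == p.1)%:R.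
pose r (i : nat * 'I_K) (x : X i.2) : R := expR (e i.2 * llr_step i.2 x).
have mr i : measurable_fun setT (r i).
  apply: measurableT_comp => //; apply: measurable_funM => //.
  exact: measurable_llr_step.
have r0 i x : 0 <= r i x by exact: expR_ge0.
have PQ (i : nat * 'I_K) (C : set (X i.2)) : measurable C ->
    (\int[P A]_(w in obs i.1 i.2 @^-1` C) (r i (obs i.1 i.2 w))%:E =
     P (swap A p) (obs i.1 i.2 @^-1` C))%E.
  case: i C => s k /= C mC; rewrite /r /=.
  have inS := in_swap k sp.
  have same i : (k \in A) = i -> (k \in swap A p) = ~~ i ->
      (\int[P A]_(w in obs s k @^-1` C)
         (expR (- ((-1) ^+ (~~ i) * llr_step k (obs s k w))))%:E =
       P (swap A p) (obs s k @^-1` C))%E.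
    move=> kA kS; under eq_integral do rewrite -scoreE.
    apply: (change_law_score (mf i k) (mf (~~ i) k) (f0 i k) (f0 (~~ i) k)
      (ae_same_support i k) (mobs s k)) => // D mD.
      by rewrite law// kA.
    by rewrite law// kS.
  have [kp1|kp1] := eqVneq k p.1.
    have kA : (k \in A) = true by rewrite kp1; case/andP: sp.
    have ek : e k = -1 by rewrite /e kp1 eqxx (negbTE p12) sub0r.
    rewrite -(same true kA); last by rewrite inS kp1 eqxx.
    by apply: eq_integral => w _; rewrite ek mulN1r expr0 mul1r.
  have [kp2|kp2] := eqVneq k p.2.
    have kA : (k \in A) = false by rewrite kp2; case/andP: sp => _ /negbTE.
    have ek : e k = 1 by rewrite /e (negbTE kp1) kp2 eqxx subr0.
    rewrite -(same false kA); last by rewrite inS (negbTE kp1) kp2 eqxx.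
    by apply: eq_integral => w _; rewrite ek mul1r expr1 mulN1r opprK.
  move: inS; rewrite (negbTE kp1) (negbTE kp2) => inS.
  transitivity (\int[P A]_(w in obs s k @^-1` C) (cst 1%E w))%E.
    apply: eq_integral => w _.
    by rewrite /e (negbTE kp1) (negbTE kp2) subrr mul0r expR0.
  have mC' : measurable (obs s k @^-1` C).
    by rewrite -[X in measurable X]setTI; exact: mobs.
  have <- : P A (obs s k @^-1` C) = P (swap A p) (obs s k @^-1` C).
    by rewrite !law// inS.
  by rewrite integral_cst// mul1e.
rewrite -(change_of_law (Y := fun i : nat * 'I_K => obs i.1 i.2)
  (fun i => mobs i.1 i.2) (indep A) (indep (swap A p)) mr r0 PQ (Ffilt_cylinder FE)).
apply: eq_integral => w _; congr EFin.
rewrite (prod_window (fun i => r i (obs i.1 i.2 w))).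
rewrite /gap /walk -sumrB -sumrN expR_sum; apply: eq_bigr => s _.
rewrite (bigD1 p.1)//= (bigD1 p.2) ?(eq_sym p.2)//= big1 ?mulr1; last first.
  move=> k /andP[k1 k2].
  by rewrite /r /= /e (negbTE k1) (negbTE k2) subrr mul0r expR0.
have e1 : e p.1 = -1 by rewrite /e eqxx (negbTE p12) sub0r.
have e2 : e p.2 = 1 by rewrite /e eqxx eq_sym (negbTE p12) subr0.
by rewrite /r /= e1 e2 -expRD; congr expR; ring.
Qed.

Lemma ae_finite_log_ratios A :
  {ae P A, forall w, forall s k,
    log_ratio (f true k) (f false k) (obs s k w) = (llr_step k (obs s k w))%:E}.
Proof.
apply/ae_foralln => s; apply: filter_forall => k.
pose N := [set w | ~ (0 < f (k \in A) k (obs s k w) /\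
                      0 < f (~~ (k \in A)) k (obs s k w))].
exists N; split.
- rewrite (_ : N = ~` ([set w | 0 < f (k \in A) k (obs s k w)] `&`
     [set w | 0 < f (~~ (k \in A)) k (obs s k w)]))//.
  have mpos i : measurable [set w | 0 < f i k (obs s k w)].
    rewrite -[X in measurable X]setTI.
    by apply: measurable_fun_ltr => //; exact: (measurableT_comp (mf i k) (mobs s k)).
  by apply: measurableC; exact: measurableI.
- exact: (prob_pos_densities (mf (k \in A) k) (mf (~~ (k \in A)) k)
    (f0 (k \in A) k) (ae_same_support (k \in A) k) (law A s k)).
- move=> w /=; apply: contra_not => -[h1 h2].
  have h i : 0 < f i k (obs s k w) by move: h1 h2; case: (k \in A) i => -[].
  by rewrite log_ratioE// !h.
Qed.

End streams_with_densities.

(** * Second-order optimality *)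

Lemma limf_esup_right_lt_pinfty {R : realType} (g : R -> \bar R) (C : R) :
  (forall x, 0 < x -> x < 1 -> (g x <= C%:E)%E) ->
  (limf_esup g (0 : R)^'+ < +oo)%E.
Proof.
move=> gC; apply: (@le_lt_trans _ _ C%:E); last exact: ltry.
rewrite limf_esupE; apply: (@le_trans _ _ (ereal_sup (g @` [set x | 0 < x < 1]))).
  apply: ereal_inf_lbound; exists [set x | 0 < x < 1] => //.
  near=> x; apply/andP; split.
    by near: x; exact: nbhs_right_gt.
  by near: x; exact: nbhs_right_lt.
by apply: ge_ereal_sup => _ [x /andP[x0 x1] <-]; exact: gC.
Unshelve. all: by end_near. Qed.

Lemma lee_subr_of_leD {R : realType} (x y : \bar R) (C : R) :
  (0 <= x)%E -> (x <= y + C%:E)%E -> (x - y <= C%:E)%E.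
Proof.
case: y => [r| |] x0 h; last by have := le_trans x0 h.
- by rewrite leeBlDr// addeC.
- by rewrite addeNy leNye.
Qed.

Unset Implicit Arguments.

Theorem theorem11 (R : realType) (K m : nat)
    (hK : (2 <= K)%N) (hm1 : (1 <= m)%N) (hmK : (m < K)%N)
    (dX : 'I_K -> measure_display) (X : forall k : 'I_K, measurableType (dX k))
    (mu : forall k : 'I_K, {sigma_finite_measure set (X k) -> \bar R})
    (f : bool -> forall k : 'I_K, X k -> R)
    (hf : forall (i : bool) (k : 'I_K), is_density (mu k) (f i k))
    (dO : measure_display) (Omega : measurableType dO)
    (obs : nat -> forall k : 'I_K, Omega -> X k)
    (P : {set 'I_K} -> probability Omega R)
    (hlaw : streams_law mu f obs P)
    (hKL : forall (k : 'I_K) (i : bool),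
      (0 < \int[mu k]_x (log_ratio (f i k) (f (~~ i) k) x * (f i k x)%:E))%E)
    (hL2 : forall (k : 'I_K) (i : bool),
      (\int[mu k]_x ((log_ratio (f i k) (f (~~ i) k) x) ^+ 2 * (f i k x)%:E)
         < +oo)%E) :
  let b (alpha : R) : R := `|ln alpha| + ln ((m * (K - m))%N%:R) in
  second_order_optimal P (signals m)
    (fun alpha => gap_rule f obs m (b alpha))
    (fun alpha => Delta_kns obs P m alpha).
Proof.
move=> b A; rewrite inE => /eqP cA.
have mobs s k : measurable_fun setT (obs s k) by have [] := hlaw.
have indep : mutually_independent (P A) (fun i : nat * 'I_K => obs i.1 i.2).
  by have [] := hlaw.
pose N : R := (m * (K - m))%N%:R.
have N0 : 0 < N by rewrite ltr0n muln_gt0 hm1 subn_gt0.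
have msc := measurable_llr_step hf.
have sq_sc := sq_integrable_llr_step hf hlaw hL2 A.
have mean_sc := mean_stepE hf hlaw A.
have sq_mean_sc := sq_mean_stepE hf hlaw A.
have [dmin d0 dminE] := finite_pos_lower_bound
  (separating_drift hf hlaw hKL hL2 (B := A)).
pose S : R := \sum_(p | separating A p)
  2 * (sq_mean_step mu f A p.1 + sq_mean_step mu f A p.2).
have S0 : 0 <= S.
  apply: sumr_ge0 => p _; rewrite mulr_ge0// addr_ge0// -(sq_mean_sc 0%N);
    by apply: Rintegral_ge0 => w _; exact: sqr_ge0.
(* the least value to which [lyapunov_drift] applies *)
pose M := (S + 1) / (2 * dmin).
have M0 : 0 <= M by rewrite divr_ge0 ?addr_ge0// mulr_ge0// ltW.
have ME : S + 1 <= 2 * dmin * M.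
  by rewrite /M mulrC divfK// gt_eqF// mulr_gt0.
pose C1 : R := 4 * N * expR M + (4 * (4 + (ln N + M) ^+ 2) + 8).
pose C : R := \sum_(p | separating A p) C1.
have [Z [mZ Z0 ZP]] := ae_finite_log_ratios hf hlaw hL2 A.
suff key alpha : 0 < alpha -> alpha < 1 -> forall delta,
    Delta_kns obs P m alpha delta ->
    (Etime P A (TG f obs m (b alpha)) <= Etime P A delta.1 + C%:E)%E.
  apply: (@limf_esup_right_lt_pinfty _ _ C) => alpha a0 a1.
  apply: lee_subr_of_leD.
    apply: integral_ge0 => w _; rewrite /gap_rule /=.
    by case: (TG f obs m (b alpha) w) => [n|] /=; rewrite ?lee_fin ?leey.
  rewrite -leeBlDr//; apply: le_ereal_inf_tmp => _ [delta hdelta <-].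
  by rewrite leeBlDr//; exact: key.
move=> a0 a1 [T D] [[stopT Dm FstopD] err] /=.
have mL t : measurable [set w | time_le (T w) t].
  by apply: (Ffilt_measurable mobs (t := t)); exact: (Ffilt_stopped stopT).
have mN t : measurable (gap_below obs (llr_step f) A (b alpha) t).
  by apply: (Ffilt_measurable mobs (t := t)); exact: Ffilt_gap_below.
have errA := err A; rewrite inE cA eqxx in errA.
have swapm p : separating A p -> swap A p \in signals m.
  by move=> sp; rewrite inE card_swap// cA.
(* the time after [T] is bounded by the Lyapunov function, the time before [T]
   by the mean of [T] itself *)
have excess n : (\sum_(t < n) P A (gap_below obs (llr_step f) A (b alpha) t
    `&` stopped T t) <= C%:E)%E.
  have errQ p : separating A p ->
      (P (swap A p) [set w | D w = A] <= alpha%:E)%E.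
    move=> sp; apply: le_trans (err _ (swapm p sp)).
    apply: le_measure; rewrite ?inE.
    - exact: (measurable_decision mobs FstopD).
    - rewrite (_ : mkset _ = ~` [set w | D w = swap A p])//.
      by apply: measurableC; exact: (measurable_decision mobs FstopD).
    - by move=> w /= -> /esym /eqP; rewrite (negbTE (swap_neq sp)).
  have := excess_bound mobs msc (Q := fun p => P (swap A p))
    (fun p sp t E => change_to_swap hf hlaw hL2 sp) stopT FstopD
    indep sq_sc mean_sc sq_mean_sc (b alpha) n (ltW d0) M0 dminE ME (errA isT) errQ.
  move=> /le_trans; apply; rewrite sumEFin lee_fin; apply: ler_sum => p _.
  exact: threshold_bound.
have partial n : (\sum_(t < n) P A (gap_below obs (llr_step f) A (b alpha) t) <=
    Etime P A T + C%:E)%E.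
  apply: (@le_trans _ _ (\sum_(t < n) (P A [set w | ~~ time_le (T w) t] +
      P A (gap_below obs (llr_step f) A (b alpha) t `&` stopped T t))))%E.
    apply: lee_sum => t _.
    have mL' : measurable [set w | ~~ time_le (T w) t].
      rewrite (_ : mkset _ = ~` [set w | time_le (T w) t]); first exact: measurableC.
      by apply/seteqP; split => w /= /negP.
    have mNL := measurableI _ _ (mN t) (mL t).
    apply: (le_trans _ (measureU2 _ mL' mNL)).
    apply: le_measure; rewrite ?inE; [exact: mN|exact: measurableU|].
    move=> w h; have [Tw|Tw] := boolP (time_le (T w) t); last by left.
    by right.
  rewrite big_split /=; apply: leeD; last exact: excess.
  exact: sum_prob_le_etime.
(* the gap rule is compared with the walks outside the null set [Z] only *)
have stopG w t : ~~ time_le (TG f obs m (b alpha) w) t ->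
    (gap_below obs (llr_step f) A (b alpha) t `|` Z) w.
  have [Zw|Zw] := pselect (Z w); first by right.
  move=> nT; left => s /andP[s0 st]; apply: contra nT => gs.
  have := @gaps_above_TG _ _ _ _ _ _ f obs (llr_step f) A m (b alpha) s w
    s0 cA hm1 hmK _ gs.
  suff h k : llr f obs s k w = (walk obs (llr_step f) s k w)%:E.
    move=> /(_ h); case: (TG f obs m (b alpha) w) => //= n ns; exact: leq_trans ns st.
  apply: llr_walk => u; apply: contrapT => nE; apply: Zw; apply: ZP => /= h.
  by apply: nE; exact: h.
have mG t : measurable (gap_below obs (llr_step f) A (b alpha) t `|` Z).
  exact: measurableU.
apply: (le_trans (etime_le_nneseries (P A) mG stopG)).
apply: lime_le.
  by apply: is_cvg_nneseries => t _ _; exact: measure_ge0.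
apply: nearW => n; rewrite big_mkord; apply: le_trans (partial n).
apply: lee_sum => t _; apply: (le_trans (measureU2 _ (mN t) mZ)).
rewrite -[leRHS]adde0; apply: leeD => //.
by rewrite le_eqVlt; apply/orP; left; apply/eqP; exact: Z0.
Qed.
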